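(* Let $M$ be a compact (connected) Riemannian manifold of dimension $n$, equipped with its geodesic distance, let $r>0$, and let $p=\mathrm{pack}_M(r)$ be the packing number of $M$ at scale $r$. Then the covering dimension of $\mathrm{AVR}^m(M;r)$ is at most $(n+1)p-1$.
   Context: For a metric space $(X,d)$, a subset $S\subseteq X$ is an $r$-packing if $d(x,x')\ge r$ for all $x,x'\in S$ with $x\ne x'$; the packing number $\mathrm{pack}_X(r)$ is the largest cardinality of an $r$-packing of $X$. For $r\ge 0$, the anti-Vietoris--Rips metric thickening $\mathrm{AVR}^m(X;r)$ is the set of all finitely supported probability measures $\sum_{i=0}^k\lambda_i\delta_{x_i}$ on $X$ (with $k\ge 0$, $\lambda_i>0$, $\sum_i\lambda_i=1$, the $x_i$ distinct) such that $d(x_i,x_j)\ge r$ for all $i\ne j$. It is equipped with the (topology of the) $1$-Wasserstein metric $W_1(\mu,\nu)=\inf_{\pi}\int_{X\times X}d(x,y)\,d\pi$, where the infimum is over probability measures $\pi$ on $X\times X$ with marginals $\mu$ and $\nu$. The covering dimension of a topological space $Y$ is at most $m$ if every open cover of $Y$ has an open refinement such that no point of $Y$ lies in more than $m+1$ sets of the refinement. *)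

(* Defs.v *)
From HB Require Import structures.
From mathcomp Require Import all_boot all_order all_algebra.
From mathcomp Require Import all_classical all_reals all_analysis.

Set Implicit Arguments.
Unset Strict Implicit.
Unset Printing Implicit Defensive.

Import Order.TTheory GRing.Theory Num.Theory.
Import numFieldNormedType.Exports.

Local Open Scope classical_set_scope.
Local Open Scope card_scope.
Local Open Scope ring_scope.

(* The library's measurable types are pointed, hence so are the metric spaces
   that carry a Borel sigma-algebra below. *)
#[short(type="pmetricType")]
HB.structure Definition PointedMetric (K : numDomainType) :=
  { M of Pointed M & Metric K M }.

Definition r_packing (R : realType) (X : metricType R) (r : R) (A : set X) :
    Prop :=
  forall x y, A x -> A y -> x <> y -> r <= mdist x y.

Definition is_packing_number (R : realType) (X : metricType R) (r : R)
    (p : nat) : Prop :=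
  (exists2 A : set X, r_packing r A & A #= `I_p) /\
  (forall A : set X, r_packing r A -> A #<= `I_p).

(* Junk value 0 if there is no largest finite r-packing, which cannot happen
   in a compact space for r > 0. *)
Definition packing_number (R : realType) (X : metricType R) (r : R) : nat :=
  xget 0%N [set p | is_packing_number X r p].

Definition borel (R : realType) (X : pmetricType R) :=
  g_sigma_algebraType (@open X).

(* The product carries the product sigma-algebra; it is the Borel one
   whenever X is separable. *)
Definition coupling (R : realType) (X : pmetricType R)
    (mu nu : probability (borel X) R) :
    set (probability (borel X * borel X)%type R) :=
  [set pi | forall A : set (borel X), measurable A ->
     pi (A `*` setT) = mu A /\ pi (setT `*` A) = nu A].

Definition wasserstein1 (R : realType) (X : pmetricType R)
    (mu nu : probability (borel X) R) : \bar R :=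
  ereal_inf [set (\int[pi]_z (mdist (z.1 : X) (z.2 : X))%:E)%E
            | pi in coupling mu nu].

(* The equality is between functions on all subsets of X (a library measure is
   a total set function, constrained on measurable sets only), so that each
   measure is represented exactly once. *)
Definition is_avr (R : realType) (X : pmetricType R) (r : R)
    (mu : probability (borel X) R) : Prop :=
  exists (k : nat) (x : 'I_k.+1 -> X) (lambda : 'I_k.+1 -> R),
    [/\ forall i, 0 < lambda i,
        \sum_i lambda i = 1,
        injective x,
        forall i j, i != j -> r <= mdist (x i) (x j) &
        forall A : set (borel X),
          mu A = (\sum_i (lambda i)%:E * \d_(x i : borel X) A)%E].

Definition AVR (R : realType) (X : pmetricType R) (r : R) : Type :=
  {mu : probability (borel X) R | is_avr r mu}.

Section AVR_topology.
Context (R : realType) (X : pmetricType R) (r : R).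

HB.instance Definition _ := gen_eqMixin (AVR X r).
HB.instance Definition _ := gen_choiceMixin (AVR X r).

Definition wasserstein_open (U : set (AVR X r)) : Prop :=
  forall mu, U mu -> exists2 e : R, 0 < e &
    forall nu, (wasserstein1 (sval mu) (sval nu) < e%:E)%E -> U nu.

Let openT : wasserstein_open setT.
Proof. by move=> mu _; exists 1. Qed.

Let openI : setI_closed wasserstein_open.
Proof.
move=> U V oU oV mu [/oU [e e0 eU] /oV [f f0 fV]].
exists (Num.min e f); first by rewrite lt_min e0 f0.
move=> nu mn; split.
- by apply: eU; apply: (lt_le_trans mn); rewrite lee_fin ge_min lexx.
- by apply: fV; apply: (lt_le_trans mn); rewrite lee_fin ge_min lexx orbT.
Qed.

Let open_bigU (I : Type) (f : I -> set (AVR X r)) :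
  (forall i, wasserstein_open (f i)) -> wasserstein_open (\bigcup_i f i).
Proof.
move=> of_ mu [i _ /of_ [e e0 eU]]; exists e => // nu mn.
by exists i => //; exact: eU.
Qed.

HB.instance Definition _ :=
  isOpenTopological.Build (AVR X r) openT openI open_bigU.

End AVR_topology.

Definition open_cover (Y : topologicalType) (C : set (set Y)) : Prop :=
  C `<=` open /\ forall y, exists2 U, C U & U y.

Definition covering_dim_le (Y : topologicalType) (m : nat) : Prop :=
  forall C : set (set Y), open_cover C ->
  exists2 D : set (set Y), open_cover D &
    (forall V, D V -> exists2 U, C U & V `<=` U) /\
    (forall y, [set V | D V /\ V y] #<= `I_m.+1).

(* For U open: f is C^k on U, by existence and continuity of all iterated
   directional derivatives up to order k. *)
Fixpoint Ck_on (R : realType) (V W : normedModType R) (k : nat) (U : set V)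
    (f : V -> W) : Prop :=
  (forall u, U u -> continuous_at u f) /\
  (if k is k'.+1 then
     forall v, (forall u, U u -> derivable f u v) /\
               Ck_on k' U (fun u => derive f u v)
   else True).

Definition smooth_on (R : realType) (V W : normedModType R) (U : set V)
    (f : V -> W) : Prop :=
  forall k, Ck_on k U f.

(* chart i and chart_inv i are total functions, meaningful only on chart_dom i
   and its image. chart_at makes the domains cover M. *)
Record smooth_atlas (R : realType) (n : nat) (M : topologicalType) := {
  chart_index : Type;
  chart_dom : chart_index -> set M;
  chart : chart_index -> M -> 'rV[R]_n;
  chart_inv : chart_index -> 'rV[R]_n -> M;
  chart_at : M -> chart_index;
  chart_at_dom : forall x, chart_dom (chart_at x) x;
  chart_dom_open : forall i, open (chart_dom i);
  chart_img_open : forall i, open (chart i @` chart_dom i);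
  chartK : forall i x, chart_dom i x -> chart_inv i (chart i x) = x;
  chart_continuous : forall i x, chart_dom i x -> continuous_at x (chart i);
  chart_inv_continuous : forall i u,
    (chart i @` chart_dom i) u -> continuous_at u (chart_inv i);
  transition_smooth : forall i j,
    smooth_on (chart i @` (chart_dom i `&` chart_dom j))
              (chart j \o chart_inv i)
}.

(* A smooth metric tensor, given by its Gram matrix in each chart, subject to
   the tensor transformation law on overlaps. *)
Record riemannian_metric (R : realType) (n : nat) (M : topologicalType)
    (S : smooth_atlas R n M) := {
  gram : chart_index S -> 'rV[R]_n -> 'M[R]_n;
  gram_smooth : forall i, smooth_on (chart i @` chart_dom i) (gram i);
  gram_sym : forall i u, (chart i @` chart_dom i) u -> (gram i u)^T = gram i u;
  gram_pos : forall i u, (chart i @` chart_dom i) u ->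
    forall v : 'rV[R]_n, v != 0 -> 0 < (v *m gram i u *m v^T) 0 0;
  gram_transition : forall i j u,
    (chart i @` (chart_dom i `&` chart_dom j)) u ->
    forall v w : 'rV[R]_n,
      let tau := chart j \o chart_inv i in
      v *m gram i u *m w^T =
      derive tau u v *m gram j (tau u) *m (derive tau u w)^T
}.

Section geodesic_distance.
Context (R : realType) (n : nat) (M : topologicalType) (S : smooth_atlas R n M).

Definition C1_curve (c : R -> M) : Prop :=
  forall t, continuous_at t c /\
    forall i : chart_index S, chart_dom i (c t) ->
      (\forall s \near t, derivable (chart i \o c) s 1) /\
      continuous_at t (derive1 (chart i \o c)).

(* On the unit interval. C^1 on a closed interval is expressed by agreeing
   there with a C^1 curve defined on the whole line. *)
Definition piecewise_C1 (c : R -> M) : Prop :=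
  exists (N : nat) (t : nat -> R),
    [/\ t 0%N = 0, t N = 1 &
        forall k, (k < N)%N -> t k < t k.+1 /\
          exists2 c', C1_curve c' &
            forall s, t k <= s <= t k.+1 -> c s = c' s].

(* By gram_transition the chart used at c s is irrelevant wherever c is
   differentiable. *)
Definition speed (g : riemannian_metric S) (c : R -> M) (s : R) : R :=
  let i := chart_at S (c s) in
  let v := derive1 (chart i \o c) s in
  Num.sqrt ((v *m gram g i (chart i (c s)) *m v^T) 0 0).

Definition curve_length (g : riemannian_metric S) (c : R -> M) : \bar R :=
  (\int[lebesgue_measure]_(s in `[0%R, 1%R]) (speed g c s)%:E)%E.

Definition geodesic_distance (g : riemannian_metric S) (x y : M) : \bar R :=
  ereal_inf [set curve_length g c
            | c in [set c | [/\ piecewise_C1 c, c 0 = x & c 1 = y]]].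

End geodesic_distance.

(* Main.v *)
Require Import Defs.
From HB Require Import structures.
From mathcomp Require Import all_boot all_order all_algebra.
From mathcomp Require Import all_classical all_reals all_analysis.
From mathcomp Require Import measurable_realfun.
From mathcomp Require Import ring lra zify.
Set Implicit Arguments.
Unset Strict Implicit.
Unset Printing Implicit Defensive.
Import Order.TTheory GRing.Theory Num.Theory.
Import numFieldNormedType.Exports.
Local Open Scope classical_set_scope.
Local Open Scope card_scope.
Local Open Scope ring_scope.

(** Choose a partition of unity [phi] on [M] of small mesh in which at most
    [n + 1] functions are nonzero at any point. A measure of AVR charges at most
    [p] points, so [mu |-> (\int phi_j dmu)_j] maps AVR into the part of the
    standard simplex where at most [(n + 1) p] coordinates are nonzero, a
    polyhedron of dimension [(n + 1) p - 1]. Measures with nearly equal images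
    are [W_1]-close, since mass can be moved inside the supports of the [phi_j];
    as AVR is compact, every open cover of it is therefore refined by the
    preimage of a fine open cover of the polyhedron, which may be taken of order
    [(n + 1) p].

    Both [M] and the polyhedron are finite unions of compact sets embedded in a
    Euclidean space of the right dimension, and covers are made of small order
    on one such set after the other, using that shrinking a cover cannot
    increase its order. *)

(** * Covering dimension of finite unions of embedded compact sets *)

(** Near-covering compactness is applied to the filter of finite lists of indices generated by the
    extensions of a given list, so that one list serves every point of [A]. The sets [f i] are only
    asked to be neighbourhoods, which allows closed balls. *)
Lemma compact_finite_cover (T : topologicalType) (A : set T) (I : Type)
    (f : I -> set T) :
  compact A -> (forall x, A x -> exists i, nbhs x (f i)) ->
  exists (N : nat) (g : 'I_N -> I), forall x, A x -> exists j, f (g j) x.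
Proof.
move=> /compact_near_coveringP cA fA.
pose F : set_system (seq I) := filter_from setT
  (fun s0 => [set s | forall i, List.In i s0 -> List.In i s]).
have FF : Filter F.
  apply: filter_from_filter; first by exists [::].
  move=> s1 s2 _ _; exists (s1 ++ s2) => // s /= h; split => i ii;
    by apply: h; apply/List.in_app_iff; first [by left | by right].
have [x Ax|s0 _ /= h] := cA _ F (fun s x => exists2 i, List.In i s & f i x) FF.
  have [i xi] := fA x Ax.
  exists (f i, [set s | List.In i s]) => /=.
    by split => //; exists [:: i] => //= s; apply; left.
  by move=> [y s] /= [fy si]; exists i.
have {}h := h s0 (fun i x => x).
exists (size s0), (tnth (in_tuple s0)) => x Ax.
have [i si fi] := h x Ax.
have [j ji] : exists j, tnth (in_tuple s0) j = i.
  elim: s0 si {h} => [//|a s IH] /= [<-|/IH[j <-]].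
    by exists ord0.
  by exists (lift ord0 j); rewrite !(tnth_nth a).
by exists j; rewrite ji.
Qed.

Lemma small_multiple (m u v : nat) (d : int) :
  d * m.+1%:Z = v%:Z - u%:Z -> (u < m.+1)%N -> (v < m.+1)%N -> u = v.
Proof.
move=> E um vm; have [d0|d0|d0] := ltgtP d 0.
- by exfalso; nia.
- by exfalso; nia.
- by rewrite d0 mul0r in E; lia.
Qed.

Section Grid.
Context (R : realType) (m : nat).
Implicit Types (s : R) (c : 'I_m.+1) (a : 'I_m -> int) (z : 'I_m -> R).

(* For fixed [c] these are disjoint open cubes of side [s * m.+1]; the colour
   [c] shifts the whole family by [c * s] along the diagonal. *)
Definition cell s c a : set ('I_m -> R) :=
  [set z | forall k,
     (a k)%:~R < (z k / s - c%:R) / m.+1%:R < (a k)%:~R + 1].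

(* A coordinate of [z] is a multiple of [s * m.+1] after at most one of the
   [m.+1] shifts, so one of the shifts is avoided by all [m] coordinates. *)
Lemma cell_cover s z : exists c a, cell s c a z.
Proof.
pose t c k := (z k / s - c%:R) / m.+1%:R.
suff [c hc] : exists c, forall k, t c k != (Num.floor (t c k))%:~R.
  exists c, (fun k => Num.floor (t c k)) => k; rewrite -/(t c k).
  rewrite lt_neqAle eq_sym hc floor_le_tmp /=.
  by have := floorD1_gt (t c k); rewrite intrD.
apply: contrapT => H.
have /choice[f hf] : forall c, exists k, t c k = (Num.floor (t c k))%:~R.
  move=> c; apply: contrapT => /forallNP Hc; apply: H; exists c => k.
  by apply/eqP; exact: Hc.
(* With [m.+1] colours and [m] coordinates, two colours fail at the same coordinate; being both
   integers there, they are congruent modulo [m.+1], hence equal. *)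
have /injectivePn[c [c' cc' fcc']] : ~~ injectiveb f.
  apply/negP => /injectiveP /leq_card.
  by rewrite !card_ord ltnn.
have := hf c; have := hf c'; rewrite -fcc'.
set i := Num.floor _; set j := Num.floor _ => Ei Ej.
have m0 : m.+1%:R != 0 :> R by [].
have : (j - i) * m.+1%:Z = c'%:Z - c%:Z.
  apply: (@intr_inj R); rewrite rmorphM !rmorphB /= -Ei -Ej /t -!pmulrn.
  by rewrite -mulrBl divfK//; ring.
move=> /small_multiple E; have := E (ltn_ord c) (ltn_ord c').
by move=> /val_inj cc; rewrite cc eqxx in cc'.
Qed.

(** Open unit intervals starting at distinct integers are disjoint. Hence a point meets at most one
    cell per colour, and the number of colours bounds the order of the cover. *)
Lemma cell_uniq s c a a' z : cell s c a z -> cell s c a' z -> a = a'.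
Proof.
move=> az a'z; apply/funext => k; have := az k; have := a'z k.
set t := _ / _ => /andP[h1 h2] /andP[h3 h4].
have : (a k)%:~R < (a' k + 1)%:~R :> R by rewrite intrD (lt_trans h3).
have : (a' k)%:~R < (a k + 1)%:~R :> R by rewrite intrD (lt_trans h1).
by rewrite !ltr_int; lia.
Qed.

Lemma cell_diam s c a z z' k : 0 < s -> cell s c a z -> cell s c a z' ->
  `|z k - z' k| < s * m.+1%:R.
Proof.
move=> s0 /(_ k) az /(_ k) az'.
have m0 : 0 < m.+1%:R :> R by [].
have E y : y = s * ((y / s - c%:R) / m.+1%:R * m.+1%:R + c%:R).
  by rewrite divfK ?gt_eqF// subrK mulrC divfK ?gt_eqF.
rewrite [z k]E [z' k]E; move: az az'; set t := _ / _; set t' := _ / _.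
move=> /andP[h1 h2] /andP[h3 h4].
rewrite -mulrBr normrM gtr0_norm// ltr_pM2l// opprD addrACA subrr addr0.
rewrite -mulrBl normrM [X in _ * X]gtr0_norm// gtr_pMl// ltr_norml.
by apply/andP; split; lra.
Qed.

Lemma cell_nbhs (T : topologicalType) (h : T -> 'I_m -> R) (x : T) s c a :
  (forall k, h y k @[y --> x] --> h x k) -> cell s c a (h x) ->
  \forall y \near x, cell s c a (h y).
Proof.
move=> hx ax; apply: filter_forall => k.
have /(_ _) ct : (h y k / s - c%:R) / m.+1%:R @[y --> x] -->
    (h x k / s - c%:R) / m.+1%:R.
  by apply: cvgMl; apply: cvgB; [apply: cvgMl; exact: hx|exact: cvg_cst].
have /andP[h1 h2] := ax k.
by near=> y; apply/andP; split; near: y;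
  [exact: (cvgr_gt _ ct)|exact: (cvgr_lt _ ct)].
Unshelve. all: by end_near. Qed.

End Grid.

(* "The covering dimension of [F] is at most [m]", phrased so that a further
   shrinking of the cover does not destroy the bound obtained on [F]. *)
Definition shrinks_on (T : topologicalType) (m : nat) (F : set T) : Prop :=
  forall (I : Type) (U : I -> set T),
    (forall i, open (U i)) -> (forall x, exists i, U i x) ->
  exists V : I -> set T,
    [/\ forall i, open (V i), forall i, V i `<=` U i,
        forall x, exists i, V i x &
        forall x, F x -> [set i | V i x] #<= `I_m.+1].

Section ShrinksOn.
Context (T : topologicalType) (m : nat).

Lemma shrinks_on_sub (F G : set T) :
  F `<=` G -> shrinks_on m G -> shrinks_on m F.
Proof.
move=> FG sG I U oU cU; have [V [oV VU cV dV]] := sG I U oU cU.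
by exists V; split => // x /FG; exact: dV.
Qed.

(** The cover shrunk for [F] is shrunk again for [G]; over [F] the index sets only get smaller, so
    the first bound survives. *)
Lemma shrinks_onU (F G : set T) :
  shrinks_on m F -> shrinks_on m G -> shrinks_on m (F `|` G).
Proof.
move=> sF sG I U oU cU; have [V [oV VU cV dV]] := sF I U oU cU.
have [W [oW WV cW dW]] := sG I V oV cV; exists W; split => //.
  by move=> i; exact: subset_trans (WV i) (VU i).
move=> x [Fx|Gx]; last exact: dW.
by apply: card_le_trans (dV x Fx); apply: subset_card_le => i /WV.
Qed.

Lemma shrinks_on0 : shrinks_on m (@set0 T).
Proof. by move=> I U oU cU; exists U; split=> // x. Qed.

Lemma shrinks_on_bigcup (J : finType) (F : J -> set T) :
  (forall j, shrinks_on m (F j)) -> shrinks_on m (\bigcup_j F j).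
Proof.
move=> sF; apply: (@shrinks_on_sub _ (\big[setU/set0]_j F j)).
  by move=> x [j _ Fx]; rewrite (bigD1 j)//=; left.
apply: (big_ind (shrinks_on m)) => [|A B sA sB|j _].
- exact: shrinks_on0.
- exact: shrinks_onU.
- exact: sF.
Qed.


(** Compactness acts twice: for fixed [x] it bounds from below the distance, measured through the
    injective [h], to the points of [F] outside [U i]; then it makes the bound uniform in [x]. *)
Lemma lebesgue_number (R : realType) (F : set T) (h : T -> 'I_m -> R)
    (I : Type) (U : I -> set T) :
  compact F -> closed F ->
  (forall x, F x -> forall k, h y k @[y --> x] --> h x k) ->
  (forall x y, F x -> F y -> h x = h y -> x = y) ->
  (forall i, open (U i)) -> (forall x, exists i, U i x) ->
  exists2 d : R, 0 < d & forall x, F x ->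
    exists i, forall y, F y -> (forall k, `|h x k - h y k| < d) -> U i y.
Proof.
move=> cF clF hF injh oU cU.
have sep x i : F x -> U i x -> exists2 d : R, 0 < d & forall y, F y ->
    (forall k, `|h x k - h y k| < d) -> U i y.
  move=> Fx Uix.
  have cK : compact (F `&` ~` U i).
    by apply: compact_closedI => //; exact: open_closedC.
  move: cK => /compact_near_coveringP/near_covering_withinP cK.
  have H : \forall d \near 0^'+, F `&` ~` U i `<=`
      [set y | exists k, d <= `|h x k - h y k|].
    apply: (cK R (0^'+) (fun d y => exists k, d <= `|h x k - h y k|)).
    move=> y [Fy Uiy].
    have [k hk] : exists k, h x k != h y k.
      apply: contrapT => /forallNP hxy; apply: Uiy.
      rewrite -(injh x y)//; apply/funext => k; apply/eqP/negPn/negP.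
      exact: hxy.
    have e0 : 0 < `|h x k - h y k| / 2 by rewrite divr_gt0// normr_gt0 subr_eq0.
    near=> y' d => /= _; exists k.
    have dE : d <= `|h x k - h y k| / 2.
      by near: d; apply: nbhs_right_le.
    have yE : `|h y k - h y' k| < `|h x k - h y k| / 2.
      near: y'; apply: cvgr_dist_lt => //; exact: hF.
    have := ler_distD (h y' k) (h x k) (h y k).
    rewrite (distrC (h y' k)); lra.

  have [e [e0 he]] := filter_ex (filterI (nbhs_right_gt 0) H).
  exists e => // y Fy ye; apply: contrapT => Uy.
  by have [k] := he y (conj Fy Uy); rewrite leNgt ye.
move: cF => /compact_near_coveringP/near_covering_withinP cF'.
pose P d x := exists i, forall y, F y ->
  (forall k, `|h x k - h y k| < d) -> U i y.
have H : \forall d \near 0^'+, F `<=` P d.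
  apply: cF'.
  move=> x Fx; have [i Uix] := cU x.
  have [d d0 hd] := sep x i Fx Uix.
  have d20 : 0 < d / 2 by rewrite divr_gt0.
  near=> x' e => /= _.
  have eE : e <= d / 2 by near: e; apply: nbhs_right_le.
  have xE : forall k, `|h x k - h x' k| < d / 2.
    near: x'; apply: filter_forall => k.
    by apply: cvgr_dist_lt => //; exact: hF.
  exists i => y Fy ye; apply: hd => // k.
  have := xE k; have := ye k; have := ler_distD (h x' k) (h x k) (h y k); lra.
have [e [e0 he]] := filter_ex (filterI (nbhs_right_gt 0) H).
by exists e.
Unshelve. all: by end_near. Qed.

(* The part of [U i] inside [F] is cut down to the cells assigned to [i];
   outside the closed set [F] nothing changes. *)
Lemma embedded_shrinks_on (R : realType) (F : set T) (h : T -> 'I_m -> R) :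
  compact F -> closed F ->
  (forall x, F x -> forall k, h y k @[y --> x] --> h x k) ->
  (forall x y, F x -> F y -> h x = h y -> x = y) ->
  shrinks_on m F.
Proof.
move=> cF clF hF injh I U oU cU.
have [d d0 hd] := lebesgue_number cF clF hF injh oU cU.
(* This gives the cells the side [s * m.+1 = d], the Lebesgue number. *)
pose s := d / m.+1%:R.
have s0 : 0 < s by rewrite divr_gt0.
have [[x0]|noT] := pselect (inhabited T); last first.
  by exists U; split=> [//|i //|//|x]; exfalso; exact: noT (inhabits x).
have [i0 _] := cU x0.
(* A cell reached by [F] is labelled by a member of the cover containing its part in [F]; any other
   cell gets the arbitrary label [i0]. *)
have /choice[lab labP] (ca : 'I_m.+1 * ('I_m -> int)) : exists i,
    forall x, F x -> cell s ca.1 ca.2 (h x) -> U i x.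
  have [[x [Fx cx]]|H] :=
      pselect (exists x, F x /\ cell s ca.1 ca.2 (h x)); last first.
    by exists i0 => x Fx cx; exfalso; apply: H; exists x.
  have [i Ui] := hd x Fx; exists i => y Fy cy; apply: Ui => // k.
  by have := cell_diam k s0 cx cy; rewrite /s divfK.
exists (fun i => U i `&` [set x | F x ->
  exists c a, cell s c a (h x) /\ lab (c, a) = i]); split.
- move=> i; rewrite openE => x [Ux Hx]; apply: filterI.
    by apply: open_nbhs_nbhs; split.
  have [Fx|nFx] := pselect (F x); last first.
    have : nbhs x (~` F) by apply: open_nbhs_nbhs; split => //; exact: closed_openC.
    by apply: filterS => y nFy Fy.
  have [c [a [ca li]]] := Hx Fx.
  apply: filterS (cell_nbhs (hF x Fx) ca) => y yc _.
  by exists c, a.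
- by move=> i x [].
- move=> x; have [Fx|nFx] := pselect (F x); last first.
    by have [i Ui] := cU x; exists i; split.
  have [c [a ca]] := cell_cover s (h x).
  exists (lab (c, a)); split; first exact: (labP (c, a)).
  by move=> _; exists c, a.
- move=> x Fx.
  (* The label of the unique cell of colour [c] around [h x]; the default of [xget] serves colours
     that have no such cell. *)
  pose f (c : 'I_m.+1) := lab (c, xget (fun=> 0) [set a | cell s c a (h x)]).
  apply: (@card_le_trans _ _ _ (f @` setT)).
    apply: subset_card_le => i [_ /(_ Fx) [c [a [ca <-]]]].
    exists c => //; rewrite /f; congr (lab (_, _)).
    by case: xgetP => [a' _ /= ca'|/(_ a)//]; exact: cell_uniq ca' ca.
  apply: card_le_trans (card_image_le _ _) _.
  by rewrite -(card_le_eql card_II).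
Qed.

End ShrinksOn.

(** * Compact metric spaces and manifolds *)

Lemma finset_card_le (T : finType) (A : {set T}) (k : nat) :
  [set x | x \in A] #<= `I_k -> (#|A| <= k)%N.
Proof.
rewrite -card_le_II; apply: card_le_trans.
have inj : {in [set: 'I_#|A|] &, injective (@enum_val _ (mem A))}.
  by move=> i j _ _; exact: enum_val_inj.
rewrite (card_le_eql card_II) -(card_le_eql (inj_card_eq inj)).
by apply: subset_card_le => _ [i _ <-] /=; exact: enum_valP.
Qed.

Lemma cvg_sumr (R : realType) (I : finType) (T : Type) (F : set_system T)
    {FF : Filter F} (f : I -> T -> R) (l : I -> R) :
  (forall i, f i x @[x --> F] --> l i) ->
  \sum_i f i x @[x --> F] --> \sum_i l i.
Proof. by move=> fl; apply: cvg_big => [|i _]; [exact: add_continuous|]. Qed.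

Section MetricLemmas.
Context (R : realType) (X : metricType R).

Lemma lipschitz1_continuous (f : X -> R) :
  (forall x y, f x <= f y + mdist x y) -> continuous f.
Proof.
move=> fL x; apply/(@cvgrPdist_lt _ R^o) => e e0; near=> y.
have xy : mdist x y < e.
  near: y; have := nbhsx_ballx x e e0; apply: filterS => y.
    by rewrite ballEmdist.
have := fL x y; have := fL y x; rewrite (metric_sym y x) ltr_norml => h1 h2.
apply/andP; split; lra.
Unshelve. all: by end_near. Qed.

Lemma mdist_continuous (x : X) : continuous (mdist x).
Proof.
by apply: lipschitz1_continuous => y z; rewrite (metric_sym y z) metric_triangle.
Qed.

(** The distance to the complement of [V] is 1-Lipschitz and, [V] being open, positive exactly on
    [V]. If the complement is empty, the constant 1 replaces it. *)
Lemma open_bump (V : set X) : open V ->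
  exists f : X -> R, [/\ continuous f, forall x, 0 <= f x &
    forall x, f x != 0 <-> V x].
Proof.
move=> oV; have [[b nVb]|H] := pselect (exists x, ~ V x); last first.
  exists (fun=> 1); split=> // [|x]; first exact: cst_continuous.
  split=> // _; apply: contrapT => nV; apply: H; by exists x.
pose D x := [set mdist x y | y in ~` V].
have D0 x : D x !=set0 by exists (mdist x b); exists b.
have lD x : lbound (D x) 0 by move=> _ [y _ <-]; exact: mdist_ge0.
have hD x : has_inf (D x) by split => //; exists 0.
exists (fun x => inf (D x)); split.
- apply: lipschitz1_continuous => x y; rewrite -lerBlDr.
  apply: lb_le_inf => // _ [z nz <-]; rewrite lerBlDr.
  rewrite addrC; apply: le_trans (metric_triangle x y z).
  by apply: ge_inf; [case: (hD x)|exists z].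
- by move=> x; exact: lb_le_inf.
- move=> x; split.
    move=> fx; apply: contrapT => nVx; case/eqP: fx; apply/eqP.
    rewrite eq_le lb_le_inf// andbT.
    by apply: ge_inf; [case: (hD x)|exists x => //; exact: mdistxx].
  move=> Vx; have /nbhs_ballP[e /= e0 eV] : nbhs x V.
    exact: open_nbhs_nbhs.
  rewrite gt_eqF//; apply: lt_le_trans e0 _; apply: lb_le_inf => // _ [y nVy <-].
  by rewrite leNgt; apply/negP => xy; apply: nVy; apply: eV; rewrite ballEmdist.
Qed.

Definition partition_of_unity (e : R) (N : nat) (phi : 'I_N -> X -> R) : Prop :=
  [/\ forall j, continuous (phi j), forall j x, 0 <= phi j x,
      forall x, \sum_j phi j x = 1 &
      forall j x y, phi j x != 0 -> phi j y != 0 -> mdist x y < e].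

(** A finite cover by balls of radius [e / 2] is shrunk to order [n.+1], and the bump functions of
    the shrunk sets are divided by their sum. *)
Lemma partition_of_unity_exists (n : nat) (e : R) :
  compact [set: X] -> shrinks_on n [set: X] -> 0 < e ->
  exists (N : nat) (phi : 'I_N -> X -> R), partition_of_unity e phi /\
    forall x, (#|[set j | phi j x != 0%R]%SET| <= n.+1)%N.
Proof.
move=> cX sX e0.
have e20 : 0 < e / 2 by rewrite divr_gt0.
have [N [g gX]] := @compact_finite_cover _ _ _ (fun x : X => (ball x (e / 2))°)
  cX (fun x _ => ex_intro _ x (nbhs_interior (nbhsx_ballx x _ e20))).
have [V [oV VU cV dV]] := sX _ (fun j => (ball (g j) (e / 2))°)
  (fun j => @open_interior _ _) (fun x => gX x Logic.I).
have /choice[f Hf] : forall j, exists f : X -> R,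
    [/\ continuous f, forall x, 0 <= f x & forall x, f x != 0 <-> V j x].
  by move=> j; exact: open_bump.
have fc j : continuous (f j) by case: (Hf j).
have f0 j x : 0 <= f j x by case: (Hf j).
have fV j x : f j x != 0 <-> V j x by case: (Hf j).
pose F x := \sum_j f j x.
have Fc : continuous F.
  by move=> x; apply: cvg_sumr => j; apply: fc.
have F0 x : F x != 0.
  have [i /fV fi] := cV x; rewrite gt_eqF// /F (bigD1 i)//=.
  by rewrite ltr_pwDl ?sumr_ge0// lt_neqAle eq_sym fi f0.
have phi0 j x : (f j x / F x != 0) = (f j x != 0).
  by rewrite mulf_eq0 invr_eq0 (negbTE (F0 x)) orbF.
exists N, (fun j x => f j x / F x); split; first split.
- by move=> j x; apply: cvgM; [exact: fc|apply: cvgV => //; exact: Fc].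
- by move=> j x; rewrite divr_ge0// sumr_ge0.
- by move=> x; rewrite -mulr_suml -/(F x) divff.
- move=> j x y; rewrite !phi0 => /fV/VU/interior_subset + /fV/VU/interior_subset.
  rewrite !ballEmdist /= => h1 h2; have := metric_triangle x (g j) y.
  rewrite (metric_sym x (g j)); lra.
- move=> x; apply: finset_card_le; apply: card_le_trans (dV x Logic.I).
  by apply: subset_card_le => j /=; rewrite inE phi0 => /fV.
Qed.


(** A ball of radius [r / 2] contains at most one point of an [r]-packing, so a finite cover by such
    balls bounds the size of all packings and a largest one exists. *)
Lemma packing_numberP (r : R) : compact [set: X] -> 0 < r ->
  is_packing_number X r (packing_number X r).
Proof.
move=> cX r0.
have r20 : 0 < r / 2 by rewrite divr_gt0.
have [N [g gX]] := @compact_finite_cover _ _ _ (fun x : X => ball x (r / 2))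
  cX (fun x _ => ex_intro _ x (nbhsx_ballx x _ r20)).
have /choice[f fX] : forall x, exists j, ball (g j) (r / 2) x.
  by move=> x; exact: gX.
have bound (A : set X) : r_packing r A -> A #<= `I_N.
  move=> pA; have inj : {in A &, injective f}.
    move=> x y; rewrite !inE => Ax Ay fxy; apply: contrapT => xy.
    have := pA x y Ax Ay xy; have := fX x; have := fX y.
    rewrite -fxy !ballEmdist /= => h1 h2; have := metric_triangle x (g (f x)) y.
    rewrite (metric_sym x (g _)); lra.
  rewrite -(card_le_eql (inj_card_eq inj)) (card_le_eqr card_II).
  exact: subset_card_le.
pose P k := `[< exists2 A : set X, r_packing r A & A #= `I_k >].
have exP : exists k, P k.
  by exists 0%N; apply/asboolP; exists set0; [move=> x y []|rewrite II0].
have bP k : P k -> (k <= N)%N.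
  move=> /asboolP[A /bound AN Ak].
  by rewrite -card_le_II -(card_le_eql Ak).
apply: (xgetPex 0%N (P := [set p | is_packing_number X r p])).
have [p /asboolP pP maxp] := ex_maxnP exP bP.
exists p; split=> // A pA.
have /finite_setP[k Ak] := card_le_finite (bound _ pA) (finite_II N).
rewrite (card_le_eql Ak) card_le_II; apply: maxp.
by apply/asboolP; exists A.
Qed.

Lemma packing_le (r : R) (k : nat) (x : 'I_k -> X) :
  compact [set: X] -> 0 < r ->
  (forall i j, i != j -> r <= mdist (x i) (x j)) -> (k <= packing_number X r)%N.
Proof.
move=> cX r0 xr; have [_ H] := packing_numberP cX r0.
have inj : {in [set: 'I_k] &, injective x}.
  move=> i j _ _ xij; apply/eqP/negPn/negP => /xr.
  by rewrite xij mdistxx leNgt r0.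
have := H (x @` setT); rewrite (card_le_eql (inj_card_eq inj)).
rewrite -(card_le_eql card_II) card_le_II; apply.
move=> _ _ [i _ <-] [j _ <-] ij; apply: xr.
by apply/eqP => e; apply: ij; rewrite e.
Qed.

End MetricLemmas.

(** Each point has a closed ball inside a chart domain. It is compact, the chart embeds it in
    ['rV[R]_n], and finitely many such balls cover [M]. *)
Lemma manifold_shrinks_on (R : realType) (n : nat) (M : pmetricType R)
    (S : smooth_atlas R n M) :
  compact [set: M] -> shrinks_on n [set: M].
Proof.
move=> cM.
pose B (x : M) (e : R) := [set y | mdist x y <= e].
have clB x e : closed (B x e).
  rewrite (_ : B x e = mdist x @^-1` [set t | t <= e])//.
  by apply: closed_comp => [y _|]; [exact: mdist_continuous|exact: closed_le].
have /choice[e eP] : forall x, exists e, 0 < e /\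
    B x e `<=` chart_dom (chart_at S x).
  move=> x; have /nbhs_ballP[e /= e0 eV] : nbhs x (chart_dom (chart_at S x)).
    apply: open_nbhs_nbhs; split; first exact: chart_dom_open.
    exact: chart_at_dom.
  exists (e / 2); split; first by rewrite divr_gt0.
  move=> y; rewrite /B /= => xy; apply: eV; rewrite ballEmdist /=.
  by apply: le_lt_trans xy _; rewrite ltr_pdivrMr// ltr_pMr// ltr1n.
have Bnbhs (x : M) : exists y, nbhs x (B y (e y)).
  exists x; apply: filterS (nbhsx_ballx x _ (eP x).1) => y.
  by rewrite ballEmdist /=; exact: ltW.
have [N [g gX]] := compact_finite_cover cM (fun x _ => Bnbhs x).
apply: (@shrinks_on_sub _ _ _ (\bigcup_j B (g j) (e (g j)))).
  by move=> x _; have [j xj] := gX x Logic.I; exists j.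
apply: shrinks_on_bigcup => j; set x := g j; pose i := chart_at S x.
have dom := (eP x).2; rewrite -/i in dom.
apply: (@embedded_shrinks_on _ _ R _ (fun y k => chart i y 0 k)).
- exact: subclosed_compact cM _.
- exact: clB.
- move=> y /dom Dy k.
  have := chart_continuous Dy.
  move=> /(@cvg_comp _ _ _ _ (fun v : 'rV[R]_n => v 0 k)); apply.
  exact: coord_continuous.
- move=> y z /dom Dy /dom Dz yz.
  rewrite -(chartK Dy) -(chartK Dz); congr chart_inv.
  by apply/rowP => k; have := congr1 (@^~ k) yz.
Qed.

(** * Finitely supported measures and transport *)

Section Discrete.
Import HBNNSimple.
Local Open Scope ereal_scope.
Context d (T : measurableType d) (R : realType) (I : finType).
Variables (w : I -> R) (x : I -> T).

(** Unlike in [is_avr], weights may vanish and points may coincide: transport plans may have zero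
    weights, and so may the families in [weighted_packing]. *)
Definition is_discrete (P : set T -> \bar R) : Prop :=
  forall A, P A = \sum_i (w i)%:E * \d_(x i) A.

Hypothesis w0 : forall i, (0 <= w i)%R.

Let atom (i : I) : {measure set T -> \bar R} :=
  mscale (NngNum (w0 i)) (\d_(x i)).

(** [msum] takes a sequence of measures over [nat], so [I] is enumerated and the sequence continued
    by the zero measure. *)
Let atoms (n : nat) : {measure set T -> \bar R} :=
  if insub n is Some i then atom (@enum_val I (mem I) i) else mzero.

Let atomsE (F : {measure set T -> \bar R} -> \bar R) :
  \sum_(n < #|I|) F (atoms n) = \sum_i F (atom i).
Proof.
rewrite [RHS](reindex_onto (@enum_val I (mem I)) enum_rank) /=; last first.
  by move=> i _; rewrite enum_rankK.
apply: eq_big => [i|i _]; first by rewrite enum_valK eqxx.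
by rewrite /atoms valK.
Qed.

Definition discrete : set T -> \bar R := msum atoms #|I|.

HB.instance Definition _ := Measure.on discrete.

Lemma discreteE : is_discrete discrete.
Proof. by move=> A; rewrite /discrete /msum (atomsE (fun m => m A)). Qed.

Lemma ge0_integral_is_discrete (P : {measure set T -> \bar R}) (f : T -> \bar R) :
  is_discrete P -> (forall y, 0 <= f y) -> measurable_fun setT f ->
  \int[P]_y f y = \sum_i (w i)%:E * f (x i).
Proof.
move=> PE f0 mf.
rewrite (eq_measure_integral discrete); last first.
  by move=> A _ _; rewrite PE -discreteE.
rewrite ge0_integral_measure_sum// (atomsE (fun m => \int[m]_y f y)).
apply: eq_bigr => i _; rewrite ge0_integral_mscale//= integral_dirac//.
by rewrite diracT mul1e.
Qed.

(* [f] need not be measurable: the integral of the library is then a lower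
   integral. *)
Lemma le_integral_is_discrete (P : {measure set T -> \bar R}) (f : T -> R) :
  is_discrete P -> (forall y, 0 <= f y)%R ->
  \int[P]_y (f y)%:E <= (\sum_i w i * f (x i))%:E.
Proof.
move=> PE f0; rewrite ge0_integralTE//; apply: ge_ereal_sup => _ [h /= hf <-].
have h0 y : 0 <= (h y)%:E by rewrite lee_fin; exact: fun_ge0.
have mh : measurable_fun setT (fun y => (h y)%:E).
  by apply/measurable_EFinP; exact: measurable_funP.
rewrite -integralT_nnsfun (ge0_integral_is_discrete PE h0 mh).
rewrite -sumEFin; apply: lee_sum => i _; rewrite -EFinM lee_fin.
by apply: ler_wpM2l => //; rewrite -lee_fin.
Qed.

Hypothesis w1 : (\sum_i w i = 1)%R.

Let discreteT : discrete setT = 1.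
Proof.
rewrite discreteE -[RHS]/(1%R%:E) -w1 -sumEFin; apply: eq_bigr => i _.
by rewrite diracT mule1.
Qed.

HB.instance Definition _ :=
  Measure_isProbability.Build _ _ _ discrete discreteT.

Lemma discrete_probability : exists P : probability T R, is_discrete P.
Proof. by exists discrete; exact: discreteE. Qed.

End Discrete.

Section Mean.
Context (R : realType) (X : pmetricType R).
Implicit Types (mu nu : probability (borel X) R) (psi : X -> R).

Lemma continuous_borel_measurable psi :
  continuous psi -> measurable_fun setT (psi : borel X -> R).
Proof.
move=> cpsi; apply: (measurability _ (RGenOInfty.measurableE R)) => //.
move=> _ [_ [a ->] <-]; rewrite setTI; apply: sub_sigma_algebra.
by apply: open_comp => [y _|]; [exact: cpsi|exact: interval_open].
Qed.

Definition mean mu psi : R := fine (\int[mu]_x (psi x)%:E)%E.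

Lemma integral_mean (I : finType) (w : I -> R) (x : I -> borel X) mu psi :
  is_discrete w x mu -> (forall i, 0 <= w i) -> continuous psi ->
  (forall y, 0 <= psi y) ->
  (\int[mu]_x (psi x)%:E = (\sum_i w i * psi (x i))%:E)%E.
Proof.
move=> muE w0 cpsi psi0.
have ps0 y : (0 <= (psi y)%:E)%E by rewrite lee_fin.
have mpsi : measurable_fun setT (fun y : borel X => (psi y)%:E).
  apply/measurable_EFinP.
  exact: (continuous_borel_measurable cpsi).
rewrite (ge0_integral_is_discrete w0 muE ps0 mpsi) -sumEFin.
by apply: eq_bigr => i _; rewrite EFinM.
Qed.

Lemma meanE (I : finType) (w : I -> R) (x : I -> borel X) mu psi :
  is_discrete w x mu -> (forall i, 0 <= w i) -> continuous psi ->
  (forall y, 0 <= psi y) -> mean mu psi = \sum_i w i * psi (x i).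
Proof. by move=> muE w0 cpsi psi0; rewrite /mean (integral_mean muE). Qed.

End Mean.

(* Mass is first matched inside each class [j], as much as the class masses
   allow; what is left over is matched arbitrarily. *)
Lemma transport_plan_exists (R : realType) (I K J : finType)
    (a : I -> J -> R) (b : K -> J -> R) :
  (forall i j, 0 <= a i j) -> (forall k j, 0 <= b k j) ->
  \sum_i \sum_j a i j = 1 -> \sum_k \sum_j b k j = 1 ->
  exists q : I -> K -> R,
    [/\ forall i k, 0 <= q i k,
        forall i, \sum_k q i k = \sum_j a i j,
        forall k, \sum_i q i k = \sum_j b k j &
        forall (c : I -> K -> R) (e B : R), 0 <= e ->
          (forall i k, 0 <= c i k <= B) ->
          (forall i k j, a i j != 0 -> b k j != 0 -> c i k <= e) ->
          \sum_i \sum_k q i k * c i k <=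
            e + B * \sum_j `|\sum_i a i j - \sum_k b k j|].
Proof.
move=> a0 b0 a1 b1.
pose t j := \sum_i a i j; pose s j := \sum_k b k j.
pose m j := Num.min (t j) (s j).
have t0 j : 0 <= t j by exact: sumr_ge0.
have s0 j : 0 <= s j by exact: sumr_ge0.
have m0 j : 0 <= m j by rewrite le_min t0 s0.
have mt j : m j <= t j by rewrite ge_min lexx.
have ms j : m j <= s j by rewrite ge_min lexx orbT.
have at0 i j : t j = 0 -> a i j = 0 by move=> tj; exact: (psumr_eq0P _ tj).
have bs0 k j : s j = 0 -> b k j = 0 by move=> sj; exact: (psumr_eq0P _ sj).
have mt0 j : t j = 0 -> m j = 0.
  by move=> tj; apply/eqP; rewrite eq_le m0 andbT -tj.
have ms0 j : s j = 0 -> m j = 0.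
  by move=> sj; apply/eqP; rewrite eq_le m0 andbT -sj.
have tE : \sum_j t j = 1 by rewrite -a1 exchange_big.
have sE : \sum_j s j = 1 by rewrite -b1 exchange_big.
pose D := 1 - \sum_j m j.
have DtE : D = \sum_j (t j - m j) by rewrite sumrB tE.
have DsE : D = \sum_j (s j - m j) by rewrite sumrB sE.
pose al i := \sum_j a i j * (1 - m j / t j).
pose be k := \sum_j b k j * (1 - m j / s j).
have ratio (u v : R) : 0 <= u -> u <= v -> 0 <= v -> 0 <= 1 - u / v.
  move=> u0 uv v0; have [->|vn0] := eqVneq v 0; first by rewrite invr0 mulr0 subr0.
  by rewrite subr_ge0 ler_pdivrMr ?mul1r// lt_neqAle eq_sym vn0.
have al0 i : 0 <= al i.
  by apply: sumr_ge0 => j _; rewrite mulr_ge0// ratio.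
have be0 k : 0 <= be k.
  by apply: sumr_ge0 => j _; rewrite mulr_ge0// ratio.
have alE : \sum_i al i = D.
  rewrite /al exchange_big DtE /=; apply: eq_bigr => j _.
  rewrite -mulr_suml -/(t j) mulrBr (mulr1 (t j)); congr (_ - _).
  have [tj|tj] := eqVneq (t j) 0; first by rewrite tj mt0// mul0r.
  by rewrite mulrC divfK.
have beE : \sum_k be k = D.
  rewrite /be exchange_big DsE /=; apply: eq_bigr => j _.
  rewrite -mulr_suml -/(s j) mulrBr (mulr1 (s j)); congr (_ - _).
  have [sj|sj] := eqVneq (s j) 0; first by rewrite sj ms0// mul0r.
  by rewrite mulrC divfK.
have D0 : 0 <= D by rewrite -alE sumr_ge0.
have alD i : D = 0 -> al i = 0.
  by move=> d0; have := alE; rewrite d0 => /psumr_eq0P; apply.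
have beD k : D = 0 -> be k = 0.
  by move=> d0; have := beE; rewrite d0 => /psumr_eq0P; apply.
(* [q1] matches mass [m j] in class [j] by a normalised product; [q2] does the same for the
   leftovers [al] and [be], each of total mass [D]. Where a denominator is 0 the quotient is 0, as
   it should be, for the numerator vanishes too. *)
pose q1 i k := \sum_j a i j * b k j * (m j / (t j * s j)).
pose q2 i k := al i * be k / D.
have r0 j : 0 <= m j / (t j * s j) by apply: divr_ge0 => //; exact: mulr_ge0.
have q10 i k : 0 <= q1 i k.
  by apply: sumr_ge0 => j _; apply: mulr_ge0 => //; exact: mulr_ge0.
have q20 i k : 0 <= q2 i k by apply: divr_ge0 => //; exact: mulr_ge0.
have row1 i : \sum_k q1 i k = \sum_j a i j * (m j / t j).
  rewrite exchange_big; apply: eq_bigr => j _ /=.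
  under eq_bigr do rewrite -mulrA.
  rewrite -mulr_sumr -mulr_suml -/(s j); congr (_ * _).
  have [sj|sj] := eqVneq (s j) 0; first by rewrite sj ms0// !mul0r.
  by rewrite invfM [(t j)^-1 * _]mulrC mulrCA mulVKf.
have col1 k : \sum_i q1 i k = \sum_j b k j * (m j / s j).
  rewrite exchange_big; apply: eq_bigr => j _ /=.
  under eq_bigr do rewrite [a _ _ * _]mulrC -mulrA.
  rewrite -mulr_sumr -mulr_suml -/(t j); congr (_ * _).
  have [tj|tj] := eqVneq (t j) 0; first by rewrite tj mt0// !mul0r.
  by rewrite invfM mulrCA mulVKf.
have row2 i : \sum_k q2 i k = al i.
  rewrite /q2 -mulr_suml -mulr_sumr beE.
  have [dj|dj] := eqVneq D 0; first by rewrite alD// !mul0r.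
  by rewrite mulfK.
have col2 k : \sum_i q2 i k = be k.
  rewrite /q2; under eq_bigr do rewrite mulrAC.
  rewrite -!mulr_suml alE.
  have [dj|dj] := eqVneq D 0; first by rewrite beD// mulr0.
  by rewrite divff// mul1r.
exists (fun i k => q1 i k + q2 i k); split.
- by move=> i k; rewrite addr_ge0.
- move=> i; rewrite big_split /= row1 row2 /al -big_split /=.
  by apply: eq_bigr => j _; rewrite mulrBr mulr1 [LHS]addrC subrK.
- move=> k; rewrite big_split /= col1 col2 /be -big_split /=.
  by apply: eq_bigr => j _; rewrite mulrBr mulr1 [LHS]addrC subrK.
- move=> c e B e0 cB cE.
  have q1c i k : q1 i k * c i k <= q1 i k * e.
    rewrite /q1 !mulr_suml; apply: ler_sum => j _.
    have [aij|aij] := eqVneq (a i j) 0; first by rewrite aij !mul0r.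
    have [bkj|bkj] := eqVneq (b k j) 0; first by rewrite bkj mulr0 !mul0r.
    apply: ler_wpM2l; last exact: cE aij bkj.
    by apply: mulr_ge0 => //; exact: mulr_ge0.
  have q2c i k : q2 i k * c i k <= q2 i k * B.
    by apply: ler_wpM2l => //; case/andP: (cB i k).
  have q1s : \sum_i \sum_k q1 i k <= 1.
    rewrite -a1; apply: ler_sum => i _; rewrite row1; apply: ler_sum => j _.
    by rewrite -subr_ge0 -[X in X - _]mulr1 -mulrBr mulr_ge0// ratio.
  have q2s : \sum_i \sum_k q2 i k = D.
    by rewrite -alE; apply: eq_bigr => i _; exact: row2.
  have DE : D <= \sum_j `|t j - s j|.
    rewrite DtE; apply: ler_sum => j _; rewrite /m minEle.
    by case: ifPn => _; [rewrite subrr|exact: ler_norm].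
  (* The sign of [B] is read off from a value of [c], which exists because total masses 1 force [I]
     and [K] to be nonempty. *)
  have [[[i0 k0]]|noB] := pselect (inhabited (I * K)%type); last first.
    exfalso; move: a1; rewrite big1; first by move/eqP; rewrite eq_sym oner_eq0.
    move=> i _; exfalso; move: b1; rewrite big1.
      by move/eqP; rewrite eq_sym oner_eq0.
    by move=> k _; exfalso; exact: noB (inhabits (i, k)).
  have B0 : 0 <= B by case/andP: (cB i0 k0); exact: le_trans.
  apply: (@le_trans _ _ (\sum_i \sum_k (q1 i k * e + q2 i k * B))).
    apply: ler_sum => i _; apply: ler_sum => k _.
    by rewrite mulrDl lerD.
  have -> : \sum_i \sum_k (q1 i k * e + q2 i k * B) =
      (\sum_i \sum_k q1 i k) * e + (\sum_i \sum_k q2 i k) * B.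
    rewrite !mulr_suml -big_split; apply: eq_bigr => i _ /=.
    by rewrite !mulr_suml -big_split.
  by rewrite q2s [D * B]mulrC; apply: lerD; [rewrite ler_piMl|rewrite ler_wpM2l].
Qed.

Section Wasserstein.
Context (R : realType) (X : pmetricType R).
Implicit Types (mu nu : probability (borel X) R).

Lemma le_lower_integral d (T : measurableType d)
    (P : {measure set T -> \bar R}) (f g : T -> \bar R) :
  (forall z, 0 <= f z)%E -> (forall z, f z <= g z)%E ->
  (\int[P]_z f z <= \int[P]_z g z)%E.
Proof.
move=> f0 fg; have g0 z : (0 <= g z)%E by exact: le_trans (fg z).
rewrite !ge0_integralTE//; apply: le_ereal_sup => _ [h /= hf <-].
by exists h => // z; exact: le_trans (fg z).
Qed.

(* [rho] need not be measurable: it dominates the measurable function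
   [max 0 ((u - v - a) / b)], and lower integrals are monotone. *)
Lemma integral_le_perturb d (T : measurableType d) (P : probability T R)
    (u v rho : T -> R) (a b : R) :
  measurable_fun setT u -> measurable_fun setT v ->
  (forall z, 0 <= u z) -> (forall z, 0 <= v z) -> (forall z, 0 <= rho z) ->
  0 <= a -> 0 < b -> (forall z, u z <= v z + a + b * rho z) ->
  (\int[P]_z (u z)%:E <= \int[P]_z (v z)%:E + a%:E +
     b%:E * \int[P]_z (rho z)%:E)%E.
Proof.
move=> mu mv u0 v0 rho0 a0 b0 uv.
pose g z := Num.max 0 ((u z - v z - a) / b).
have mg : measurable_fun setT g.
  apply: measurable_maxr => //; apply: measurable_funM => //.
  by apply: measurable_funB => //; exact: measurable_funB.
have g0 z : 0 <= g z by rewrite le_max lexx.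
have grho z : g z <= rho z.
  rewrite ge_max rho0 /= ler_pdivrMr// mulrC.
  by have := uv z; lra.
have ug z : u z <= v z + a + b * g z.
  have : (u z - v z - a) / b <= g z by rewrite le_max lexx orbT.
  by rewrite ler_pdivrMr// mulrC; lra.
apply: (@le_trans _ _ (\int[P]_z ((v z + a)%:E + (b * g z)%:E))%E).
  apply: le_lower_integral => z; first by rewrite lee_fin.
  by rewrite -EFinD lee_fin.
have va0 z : (0 <= (v z + a)%:E)%E by rewrite lee_fin addr_ge0.
have bg0 z : (0 <= (b * g z)%:E)%E by rewrite lee_fin mulr_ge0// ltW.
have mva : measurable_fun setT (fun z => (v z + a)%:E).
  by apply/measurable_EFinP; exact: measurable_funD.
have mbg : measurable_fun setT (fun z => (b * g z)%:E).
  by apply/measurable_EFinP; exact: measurable_funM.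
rewrite (ge0_integralD P measurableT (fun z _ => va0 z) mva (fun z _ => bg0 z) mbg).
apply: leeD.
  have v0' z : (0 <= (v z)%:E)%E by rewrite lee_fin.
  have a0' (z : T) : (0 <= a%:E)%E by rewrite lee_fin.
  have mv' : measurable_fun setT (fun z => (v z)%:E) by exact/measurable_EFinP.
  under eq_integral do rewrite EFinD.
  rewrite (ge0_integralD P measurableT (fun z _ => v0' z) mv' (fun z _ => a0' z)
    (measurable_cst _)).
  by rewrite integral_cst//= probability_setT mule1.
have b0' := ltW b0; have g0' z : (0 <= (g z)%:E)%E by rewrite lee_fin.
have mg' : measurable_fun setT (fun z => (g z)%:E) by exact/measurable_EFinP.
under eq_integral do rewrite EFinM.
rewrite (ge0_integralZl _ measurableT mg' (fun z _ => g0' z)) ?lee_fin//.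
apply: lee_wpmul2l; first by rewrite lee_fin.
by apply: le_lower_integral => z; rewrite ?lee_fin.
Qed.


Lemma integral_coupling_fst mu nu pi (psi : X -> R) :
  coupling mu nu pi -> continuous psi -> (forall x, 0 <= psi x) ->
  (\int[pi]_z (psi z.1)%:E = \int[mu]_x (psi x)%:E)%E.
Proof.
move=> piC cpsi psi0.
have mpsi : measurable_fun setT (fun y : borel X => (psi y)%:E).
  by apply/measurable_EFinP; exact: (continuous_borel_measurable cpsi).
have mfst : measurable_fun setT (fst : borel X * borel X -> borel X).
  exact: measurable_fst.
transitivity (\int[pushforward pi fst]_(x in [set: borel X]) (psi x)%:E)%E.
  rewrite (ge0_integral_pushforward mfst pi measurableT mpsi) // => y _.
  by rewrite lee_fin.
apply: (@eq_measure_integral _ _ _ _ mu) => A mA _.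
rewrite -[RHS](piC A mA).1; congr (pi _).
by apply/seteqP; split => z //= [].
Qed.

Lemma integral_coupling_snd mu nu pi (psi : X -> R) :
  coupling mu nu pi -> continuous psi -> (forall x, 0 <= psi x) ->
  (\int[pi]_z (psi z.2)%:E = \int[nu]_x (psi x)%:E)%E.
Proof.
move=> piC cpsi psi0.
have mpsi : measurable_fun setT (fun y : borel X => (psi y)%:E).
  by apply/measurable_EFinP; exact: (continuous_borel_measurable cpsi).
have msnd : measurable_fun setT (snd : borel X * borel X -> borel X).
  exact: measurable_snd.
transitivity (\int[pushforward pi snd]_(x in [set: borel X]) (psi x)%:E)%E.
  rewrite (ge0_integral_pushforward msnd pi measurableT mpsi) // => y _.
  by rewrite lee_fin.
apply: (@eq_measure_integral _ _ _ _ nu) => A mA _.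
rewrite -[RHS](piC A mA).2; congr (pi _).
by apply/seteqP; split => z //= [].
Qed.

Lemma compact_uniform_continuity (psi : X -> R) (eta : R) :
  compact [set: X] -> continuous psi -> 0 < eta ->
  exists2 d : R, 0 < d & forall x y, mdist x y < d -> `|psi x - psi y| <= eta.
Proof.
move=> /compact_near_coveringP/near_covering_withinP cX cpsi eta0.
pose P d x := forall y, mdist x y < d -> `|psi x - psi y| <= eta.
have H : \forall d \near 0^'+, [set: X] `<=` P d.
  apply: cX => x _.
  have eta20 : 0 < eta / 2 by rewrite divr_gt0.
  have /nbhs_ballP[e /= e0 he] : \forall y \near x, `|psi x - psi y| < eta / 2.
    by apply: (@cvgr_dist_lt _ R^o) => //; exact: cpsi.
  have e20 : 0 < e / 2 by rewrite divr_gt0.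
  near=> x' d => /= _ y x'y.
  have dE : d <= e / 2 by near: d; exact: nbhs_right_le.
  have xx' : mdist x x' < e / 2.
    by near: x'; have := nbhsx_ballx x _ e20; rewrite ballEmdist.
  have h1 : `|psi x - psi x'| < eta / 2.
    by apply: he; rewrite ballEmdist /=; apply: lt_trans xx' _; lra.
  have h2 : `|psi x - psi y| < eta / 2.
    by apply: he; rewrite ballEmdist /=; have := metric_triangle x x' y; lra.
  have := ler_distD (psi x) (psi x') (psi y).
  rewrite (distrC (psi x') (psi x)); lra.
have [d [d0 hd]] := filter_ex (filterI (nbhs_right_gt 0) H).
by exists d => // x y; exact: hd.
Unshelve. all: by end_near. Qed.

Lemma integral_bounded_mean mu (psi : X -> R) :
  (forall x, 0 <= psi x <= 1) ->
  (\int[mu]_x (psi x)%:E)%E = (mean mu psi)%:E.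
Proof.
move=> psi01; rewrite /mean fineK// ge0_fin_numE; last first.
  by apply: integral_ge0 => x _; rewrite lee_fin; case/andP: (psi01 x).
apply: (@le_lt_trans _ _ (\int[mu]_x (cst 1%E x))%E).
  by apply: le_lower_integral => x; rewrite lee_fin; case/andP: (psi01 x).
by rewrite integral_cst//= probability_setT mule1 ltry.
Qed.

(** [psi] varies by at most [eta / 2 + d^-1 * mdist x y]: below distance [d] by uniform continuity,
    beyond it because its values lie in [[0, 1]]. This bound is integrated against a coupling of
    small cost. *)
Lemma mean_wasserstein_continuous (psi : X -> R) (eta : R) :
  compact [set: X] -> continuous psi -> (forall x, 0 <= psi x <= 1) ->
  0 < eta ->
  exists2 e : R, 0 < e & forall mu nu, (wasserstein1 mu nu < e%:E)%E ->
    `|mean mu psi - mean nu psi| <= eta.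
Proof.
move=> cX cpsi psi01 eta0.
have eta20 : 0 < eta / 2 by rewrite divr_gt0.
have psi0 x : 0 <= psi x by case/andP: (psi01 x).
have [d d0 hd] := compact_uniform_continuity cX cpsi eta20.
have lip x y : `|psi x - psi y| <= eta / 2 + d^-1 * mdist x y.
  have [xy|xy] := ltP (mdist x y) d.
    by rewrite (le_trans (hd _ _ xy))// lerDl mulr_ge0 ?mdist_ge0// invr_ge0 ltW.
  have : 1 <= d^-1 * mdist x y by rewrite mulrC ler_pdivlMr ?mul1r.
  have : `|psi x - psi y| <= 1.
    by have := psi01 x; have := psi01 y; rewrite ler_norml; lra.
  lra.
(* A cost below [eta / 2 * d] contributes at most [eta / 2] after multiplication by [d^-1]. *)
exists (eta / 2 * d); first exact: mulr_gt0.
move=> mu nu /ereal_inf_lt[_ [pi piC <-]] piE.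
have mpsi : measurable_fun setT (psi : borel X -> R).
  exact: continuous_borel_measurable.
have m1 : measurable_fun setT (fun z : borel X * borel X => psi z.1).
  by apply: (measurableT_comp mpsi); exact: measurable_fst.
have m2 : measurable_fun setT (fun z : borel X * borel X => psi z.2).
  by apply: (measurableT_comp mpsi); exact: measurable_snd.
have dV0 : 0 < d^-1 by rewrite invr_gt0.
have small (u v : borel X * borel X -> R) (a b : R) :
    measurable_fun setT u -> measurable_fun setT v ->
    (forall z, 0 <= u z) -> (forall z, 0 <= v z) ->
    (forall z, `|u z - v z| <= eta / 2 + d^-1 * mdist (z.1 : X) (z.2 : X)) ->
    (\int[pi]_z (u z)%:E = a%:E)%E -> (\int[pi]_z (v z)%:E = b%:E)%E ->
    a <= b + eta.
  move=> mu' mv' u0 v0 uv Ea Eb.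
  have := @integral_le_perturb _ _ pi u v
    (fun z => mdist (z.1 : X) (z.2 : X)) (eta / 2) (d^-1) mu' mv' u0 v0
    (fun z => mdist_ge0 _ _) (ltW eta20) dV0.
  rewrite Ea Eb => /(_ _) H; rewrite -lee_fin; apply: le_trans (H _) _.
    by move=> z; have := uv z; rewrite ler_norml => /andP[_]; lra.
  rewrite [X in (_ <= X%:E)%E](_ : _ = b + eta / 2 + d^-1 * (eta / 2 * d)); last first.
    by rewrite mulrCA mulVf ?gt_eqF// mulr1 -addrA -splitr.
  rewrite !EFinD leeD2l// EFinM lee_wpmul2l//; first by rewrite lee_fin ltW.
  exact: ltW.
have E1 : (\int[pi]_z (psi z.1)%:E = (mean mu psi)%:E)%E.
  by rewrite (integral_coupling_fst piC)// integral_bounded_mean.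
have E2 : (\int[pi]_z (psi z.2)%:E = (mean nu psi)%:E)%E.
  by rewrite (integral_coupling_snd piC)// integral_bounded_mean.
have h1 := small _ _ _ _ m1 m2 (fun z => psi0 _) (fun z => psi0 _)
  (fun z => lip _ _) E1 E2.
have h2 := small _ _ _ _ m2 m1 (fun z => psi0 _) (fun z => psi0 _)
  (fun z => ltac:(rewrite distrC; exact: lip)) E2 E1.
by rewrite ler_norml; apply/andP; split; lra.
Qed.

End Wasserstein.

Section Transport.
Context (R : realType) (X : pmetricType R).
Variables (I K : finType) (w : I -> R) (x : I -> borel X)
  (v : K -> R) (y : K -> borel X) (mu nu : probability (borel X) R).
Hypotheses (muE : is_discrete w x mu) (nuE : is_discrete v y nu)
  (w0 : forall i, 0 <= w i) (v0 : forall k, 0 <= v k)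
  (w1 : \sum_i w i = 1) (v1 : \sum_k v k = 1).

(** The weights [q] on the pairs [(x i, y k)] form a discrete probability on the product, a coupling
    by the marginal conditions. *)
Lemma wasserstein1_le_plan (q : I -> K -> R) :
  (forall i k, 0 <= q i k) -> (forall i, \sum_k q i k = w i) ->
  (forall k, \sum_i q i k = v k) ->
  (wasserstein1 mu nu <=
    (\sum_i \sum_k q i k * mdist (x i : X) (y k : X))%:E)%E.
Proof.
move=> q0 qw qv.
pose q' (p : I * K) := q p.1 p.2.
pose xy (p : I * K) : borel X * borel X := (x p.1, y p.2).
have q'0 p : 0 <= q' p by exact: q0.
have q'1 : \sum_p q' p = 1.
  by rewrite -w1 -(pair_bigA _ q) /=; apply: eq_bigr.
have [pi piE] := discrete_probability xy q'0 q'1.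
have piC : coupling mu nu pi.
  move=> A mA; split.
    rewrite piE muE (eq_bigr (fun p => (q p.1 p.2 * (x p.1 \in A)%:R)%:E)).
      rewrite sumEFin -(pair_bigA _ (fun i k => q i k * (x i \in A)%:R)) /=.
      rewrite -sumEFin; apply: eq_bigr => i _.
      by rewrite -mulr_suml qw EFinM diracE.
    move=> p _; rewrite diracE EFinM; congr (_ * (nat_of_bool _)%:R%:E)%E.
    by apply/idP/idP; rewrite !inE /=; [case|split].
  rewrite piE nuE (eq_bigr (fun p => (q p.1 p.2 * (y p.2 \in A)%:R)%:E)).
    rewrite sumEFin -(pair_bigA _ (fun i k => q i k * (y k \in A)%:R)) /=.
    rewrite exchange_big -sumEFin; apply: eq_bigr => k _.
    by rewrite -mulr_suml qv EFinM diracE.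
  move=> p _; rewrite diracE EFinM; congr (_ * (nat_of_bool _)%:R%:E)%E.
  by apply/idP/idP; rewrite !inE /=; [case|split].
apply: le_trans; first by apply: ereal_inf_lbound; exists pi => //; exact: piC.
have := @le_integral_is_discrete _ _ _ _ q' xy q'0 pi
  (fun z => mdist (z.1 : X) (z.2 : X)) piE (fun=> mdist_ge0 _ _).
by rewrite (pair_bigA _ (fun i k => q i k * mdist (x i : X) (y k : X))).
Qed.

Variables (N : nat) (phi : 'I_N -> X -> R) (e : R).
Hypotheses (phiP : partition_of_unity e phi) (e0 : 0 <= e).

Let cphi j : continuous (phi j). Proof. by case: phiP. Qed.
Let phi0 j z : 0 <= phi j z. Proof. by case: phiP. Qed.
Let phi1 z : \sum_j phi j z = 1. Proof. by case: phiP. Qed.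

(** Each atom is split among the classes [j] in proportion to [phi j]. Transport inside a class
    moves mass by less than [e], and the class masses are the means of [phi j]. *)
Lemma wasserstein1_le_partition (B : R) :
  (forall z z' : X, mdist z z' <= B) ->
  (wasserstein1 mu nu <=
    (e + B * \sum_j `|mean mu (phi j) - mean nu (phi j)|)%:E)%E.
Proof.
move=> dB.
pose a i j := w i * phi j (x i); pose b k j := v k * phi j (y k).
have aw i : \sum_j a i j = w i by rewrite /a -mulr_sumr phi1 mulr1.
have bv k : \sum_j b k j = v k by rewrite /b -mulr_sumr phi1 mulr1.
have a0 i j : 0 <= a i j by exact: mulr_ge0.
have b0 k j : 0 <= b k j by exact: mulr_ge0.
have [||q [q0 qa qb qc]] := @transport_plan_exists _ _ _ _ a b a0 b0.
- by rewrite -w1; exact: eq_bigr.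
- by rewrite -v1; exact: eq_bigr.
have qw i : \sum_k q i k = w i by rewrite qa aw.
have qv k : \sum_i q i k = v k by rewrite qb bv.
apply: le_trans (wasserstein1_le_plan q0 qw qv) _; rewrite lee_fin.
rewrite [X in _ <= _ + _ * X](_ : _ = \sum_j `|\sum_i a i j - \sum_k b k j|).
  apply: qc => // [i k|i k j]; first by rewrite mdist_ge0 dB.
  rewrite !mulf_eq0 !negb_or => /andP[_ ax] /andP[_ bx]; apply: ltW.
  by case: phiP => _ _ _; apply; eassumption.
apply: eq_bigr => j _; congr `|_ - _|; first exact: (meanE muE).
exact: (meanE nuE).
Qed.

(** [psi] is within [d] of a combination of the [phi j] whose coefficients [c j] in [[0, 1]] are
    sampled values of [psi], or 0 if [phi j] vanishes identically. Each of the two measures pays one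
    [d] for this approximation. *)
Lemma mean_partition_close (psi : X -> R) (d : R) :
  continuous psi -> (forall z, 0 <= psi z <= 1) ->
  (forall z z', mdist z z' < e -> `|psi z - psi z'| <= d) ->
  `|mean mu psi - mean nu psi| <=
    d + d + \sum_j `|mean mu (phi j) - mean nu (phi j)|.
Proof.
move=> cpsi psi01 osc.
have psi0 z : 0 <= psi z by case/andP: (psi01 z).
have /choice[c cP] (j : 'I_N) : exists c, 0 <= c <= 1 /\
    forall z, phi j z != 0 -> `|psi z - c| <= d.
  have [[z0 hz0]|H] := pselect (exists z, phi j z != 0).
    exists (psi z0); split=> // z hz; apply: osc.
    by case: phiP => _ _ _ /(_ j); exact.
  exists 0; rewrite lexx ler01; split=> // z hz; exfalso; apply: H.
  by exists z.
have near_c z : `|psi z - \sum_j c j * phi j z| <= d.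
  rewrite -[psi z]mulr1 -(phi1 z) mulr_sumr -sumrB.
  apply: le_trans (ler_norm_sum _ _ _) _.
  rewrite -[d]mulr1 -(phi1 z) mulr_sumr; apply: ler_sum => j _.
  rewrite -mulrBl normrM (ger0_norm (phi0 j z)).
  have [->|pz] := eqVneq (phi j z) 0; first by rewrite !mulr0.
  by rewrite ler_wpM2r// (cP j).2.
have close (L : finType) (u : L -> R) (z : L -> X) :
    (forall l, 0 <= u l) -> \sum_l u l = 1 ->
    `|\sum_l u l * psi (z l) - \sum_j c j * \sum_l u l * phi j (z l)| <= d.
  move=> u0 u1.
  have -> : \sum_j c j * \sum_l u l * phi j (z l) =
      \sum_l u l * \sum_j c j * phi j (z l).
    under eq_bigr do rewrite mulr_sumr.
    rewrite exchange_big; apply: eq_bigr => l _; rewrite mulr_sumr.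
    by apply: eq_bigr => j _; rewrite mulrCA.
  rewrite -sumrB; apply: le_trans (ler_norm_sum _ _ _) _.
  rewrite -[d]mul1r -u1 mulr_suml; apply: ler_sum => l _.
  by rewrite -mulrBr normrM (ger0_norm (u0 l)) ler_wpM2l.
have := close _ w x w0 w1; have := close _ v y v0 v1.
rewrite -(meanE muE w0 cpsi psi0) -(meanE nuE v0 cpsi psi0).
have tmu j : \sum_i w i * phi j (x i) = mean mu (phi j).
  by rewrite (meanE muE).
have tnu j : \sum_k v k * phi j (y k) = mean nu (phi j).
  by rewrite (meanE nuE).
under eq_bigr do rewrite tnu.
under [in X in _ -> X -> _]eq_bigr do rewrite tmu.
set S := \sum_j c j * mean nu _; set S' := \sum_j c j * mean mu _ => h1 h2.
have h3 : `|S' - S| <= \sum_j `|mean mu (phi j) - mean nu (phi j)|.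
  rewrite -sumrB; apply: le_trans (ler_norm_sum _ _ _) _.
  apply: ler_sum => j _; rewrite -mulrBr normrM.
  have /andP[c0 c1] := (cP j).1.
  by rewrite (ger0_norm c0) ler_piMl.
have := ler_distD S' (mean mu psi) (mean nu psi).
have := ler_distD S S' (mean nu psi).
by rewrite (distrC S); lra.
Qed.

End Transport.

(** * Compactness of the thickening *)

Section AvrCompact.
Context (R : realType) (X : pmetricType R) (r : R).
Implicit Types (mu nu : AVR X r).

Lemma avr_representation mu :
  exists (k : nat) (x : 'I_k -> X) (l : 'I_k -> R),
    [/\ forall i, 0 <= l i, \sum_i l i = 1,
        forall i j, i != j -> r <= mdist (x i) (x j) &
        is_discrete l (x : 'I_k -> borel X) (sval mu)].
Proof.
case: mu => mu /= [k [x [l [l0 l1 _ xr muE]]]].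
by exists k.+1, x, l; split => // i; exact: ltW.
Qed.

(** Weights of sum 1 make [m] a successor, and points at distance at least [r > 0] are distinct. *)
Lemma is_avr_ord (m : nat) (x : 'I_m -> X) (l : 'I_m -> R)
    (P : probability (borel X) R) :
  0 < r -> (forall i, 0 < l i) -> \sum_i l i = 1 ->
  (forall i j, i != j -> r <= mdist (x i) (x j)) ->
  is_discrete l (x : 'I_m -> borel X) P -> is_avr r P.
Proof.
move=> r0; case: m x l => [x l _|m x l l0 l1 xr PE].
  by rewrite big_ord0 => /eqP; rewrite eq_sym oner_eq0.
exists m, x, l; split => //.
move=> i j xij; apply/eqP/negPn/negP => /xr.
by rewrite xij mdistxx leNgt r0.
Qed.

(* Points of zero weight are allowed on the left, and dropped on the right. *)
Lemma avr_of_weights (k : nat) (x : 'I_k -> X) (l : 'I_k -> R) :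
  0 < r -> (forall i, 0 <= l i) -> \sum_i l i = 1 ->
  (forall i j, i != j -> r <= mdist (x i) (x j)) ->
  exists mu, is_discrete l (x : 'I_k -> borel X) (sval mu).
Proof.
move=> r0 l0 l1 xr.
have [P PE] := discrete_probability (x : 'I_k -> borel X) l0 l1.
suff aP : is_avr r P by exists (exist _ P aP).
pose A := [pred i : 'I_k | 0 < l i].
have inA (F : 'I_k -> \bar R) (F0 : forall i, l i = 0 -> F i = 0%E) :
    (\sum_i F i = \sum_(i in A) F i)%E.
  rewrite [RHS]big_mkcond; apply: eq_bigr => i _ /=.
  rewrite inE; case: ifPn => //; rewrite lt_neqAle l0 andbT negbK => /eqP li.
  exact: F0.
have lA : \sum_(i in A) l i = 1.
  apply/EFin_inj; rewrite -sumEFin -inA ?sumEFin ?l1// => i ->.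
  by [].
have PA B : P B = (\sum_(i < #|A|) (l (enum_val i))%:E *
    \d_(x (enum_val i) : borel X) B)%E.
  rewrite PE inA; last by move=> i ->; rewrite mul0e.
  by rewrite (big_enum_val (fun i => ((l i)%:E * \d_(x i : borel X) B)%E)).
have l1' : \sum_(i < #|A|) l (enum_val i) = 1 by rewrite -(big_enum_val l).
have l0' (i : 'I_#|A|) : 0 < l (enum_val i) by have := enum_valP i; rewrite inE.
have xr' (i j : 'I_#|A|) : i != j -> r <= mdist (x (enum_val i)) (x (enum_val j)).
  by move=> ij; apply: xr; apply: contra ij => /eqP/enum_val_inj ->.
exact: (is_avr_ord r0 l0' l1' xr' PA).
Qed.

Lemma mean_nbhs mu (psi : X -> R) (eta : R) :
  compact [set: X] -> continuous psi -> (forall x, 0 <= psi x <= 1) ->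
  0 < eta ->
  \forall nu \near mu, `|mean (sval mu) psi - mean (sval nu) psi| < eta.
Proof.
move=> cX cpsi psi01 eta0; apply: open_nbhs_nbhs; split; last first.
  by rewrite /= subrr normr0.
(* The topology is given by its open sets, so this set must contain a Wasserstein ball around each
   of its points, not only around [mu]. *)
suff : wasserstein_open
  [set nu : AVR X r | `|mean (sval mu) psi - mean (sval nu) psi| < eta] by [].
move=> nu /= nuE; set s := `|_| in nuE.
have d0 : 0 < (eta - s) / 2 by rewrite divr_gt0// subr_gt0.
have [e e0 he] := mean_wasserstein_continuous cX cpsi psi01 d0.
exists e => // ka /he.
have := ler_distD (mean (sval nu) psi) (mean (sval mu) psi) (mean (sval ka) psi).
by rewrite -/s; lra.
Qed.

Hypotheses (cX : compact [set: X]) (r0 : 0 < r).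

Lemma cvg_mdist (T : Type) (F : set_system T) {FF : Filter F} (f g : T -> X)
    (x y : X) :
  f z @[z --> F] --> x -> g z @[z --> F] --> y ->
  mdist (f z) (g z) @[z --> F] --> mdist x y.
Proof.
move=> fx gy; apply/(@cvgrPdist_lt _ R^o) => e e0.
have e20 : 0 < e / 2 by rewrite divr_gt0.
near=> z.
have h1 : mdist x (f z) < e / 2.
  near: z; have := fx _ (nbhsx_ballx x _ e20).
  by rewrite nbhs_simpl /= ballEmdist.
have h2 : mdist y (g z) < e / 2.
  near: z; have := gy _ (nbhsx_ballx y _ e20).
  by rewrite nbhs_simpl /= ballEmdist.
have := metric_triangle x (f z) y; have := metric_triangle (f z) (g z) y.
have := metric_triangle (f z) x (g z); have := metric_triangle x y (g z).
rewrite (metric_sym (f z) x) (metric_sym (g z) y) ltr_norml => *.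
by apply/andP; split; lra.
Unshelve. all: by end_near. Qed.

Lemma compact_dist_bounded :
  exists2 B : R, 0 < B & forall x y : X, mdist x y <= B.
Proof.
have [|N [g gX]] := @compact_finite_cover _ _ _
    (fun k : nat => [set y : X | mdist point y < k%:R]) cX.
  move=> x _; exists (Num.truncn (mdist point x)).+1.
  have /(cvgr_lt (mdist point x)) := @mdist_continuous _ X point x.
  by apply; exact: truncnS_gt.
pose G := \sum_j (g j)%:R : R.
have gG j : (g j)%:R <= G by rewrite /G (bigD1 j)//= lerDl sumr_ge0.
have G0 : 0 <= G by rewrite sumr_ge0.
exists (G + G + 1) => [|x y]; first by lra.
have [i /= xi] := gX x Logic.I; have [j /= yj] := gX y Logic.I.
have := metric_triangle x point y; rewrite (metric_sym x point).
have := gG i; have := gG j; lra.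
Qed.

Definition weighted_packing (k : nat) :
    set (prod_topology (fun _ : 'I_k => (X * R)%type)) :=
  [set f | [/\ forall i, 0 <= (f i).2 <= 1, \sum_i (f i).2 = 1 &
     forall i j, i != j -> r <= mdist (f i).1 (f j).1]].

Lemma point_weight_cvg (k : nat)
    (f : prod_topology (fun _ : 'I_k => (X * R)%type)) i :
  (g i).1 @[g --> f] --> (f i).1 /\ (g i).2 @[g --> f] --> (f i).2.
Proof.
have H := @proj_continuous _ (fun _ : 'I_k => (X * R)%type) i f.
by split; [exact: cvg_comp H cvg_fst|exact: cvg_comp H cvg_snd].
Qed.

Lemma compact_weighted_packing (k : nat) : compact (weighted_packing (k := k)).
Proof.
pose T := prod_topology (fun _ : 'I_k => (X * R)%type).
have csum : continuous (fun f : T => \sum_i (f i).2).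
  by move=> f; apply: (@cvg_sumr _ _ _ _ (nbhs_filter f)) => i; exact: (point_weight_cvg f i).2.
have cdist i j : continuous (fun f : T => mdist (f i).1 (f j).1).
  move=> f; apply: (@cvg_mdist _ _ (nbhs_filter f)); first exact: (point_weight_cvg f i).1.
  exact: (point_weight_cvg f j).1.
have cI : compact [set f : prod_topology (fun _ : 'I_k => (X * R)%type) |
    forall i, ([set: X] `*` `[0, 1]%classic) (f i)].
  apply: (@tychonoff _ (fun _ : 'I_k => (X * R)%type)
    (fun _ => [set: X] `*` `[0, 1]%classic)) => i.
  by apply: compact_setX => //; exact: segment_compact.
apply: (subclosed_compact _ cI); last first.
  move=> f [f01 _ _] i; split => //=; rewrite in_itv /=; exact: f01.
rewrite (_ : weighted_packing (k := k) =
  \bigcap_i [set f | 0 <= (f i).2 <= 1] `&` ([set f | \sum_i (f i).2 = 1] `&`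
  \bigcap_ij [set f | ij.1 != ij.2 -> r <= mdist (f ij.1).1 (f ij.2).1]));
  last first.
  apply/seteqP; split => f.
    by move=> [f1 f2 f3]; split=> [i _|]; [exact: f1|split=> // -[i j] _; exact: f3].
  by move=> [f1 [f2 f3]]; split=> // [i|i j]; [exact: (f1 i Logic.I)|exact: (f3 (i, j) Logic.I)].
apply: closedI; last apply: closedI.
- apply: closed_bigI => i _.
  rewrite (_ : [set f | _] = (fun f => (f i).2) @^-1` `[0, 1]%classic).
    apply: closed_comp => [f _|]; last exact: interval_closed.
    exact: (point_weight_cvg f i).2.
  by apply/seteqP; split => f /=; rewrite in_itv.
- rewrite (_ : [set f | _] = (fun f => \sum_i (f i).2) @^-1` [set 1])//.
  apply: closed_comp => [f _|]; last exact: closed_eq.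
  exact: csum.
- apply: closed_bigI => -[i j] _ /=.
  have [->|ij] := eqVneq i j.
    rewrite (_ : [set f | _] = setT); first exact: closedT.
    by apply/seteqP; split.
  rewrite (_ : [set f | _] = (fun f => mdist (f i).1 (f j).1) @^-1` [set t | r <= t]).
    apply: closed_comp => [f _|]; last exact: closed_ge.
    exact: cdist.
  by apply/seteqP; split => f /=; [exact|].
Qed.

End AvrCompact.

(** Apart from the set function, a packed probability consists of proofs, identified by proof
    irrelevance. *)
Lemma probability_ext d (T : measurableType d) (R : realType)
    (P Q : probability T R) :
  (forall A, P A = Q A) -> P = Q.
Proof.
case: P => P cP; case: Q => Q cQ /= PQ.
have E : P = Q by apply/funext.
case: Q / E cQ {PQ} => cQ; f_equal.
case: cP cQ => [[a b] [c] [d'] [e] [f] [g] [h]] [[+ +] [+] [+] [+] [+] [+] [+]].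
move=> a' b' c' d'' e' f' g' h'.
by rewrite (Prop_irrelevance a' a) (Prop_irrelevance b' b)
  (Prop_irrelevance c' c) (Prop_irrelevance d'' d') (Prop_irrelevance e' e)
  (Prop_irrelevance f' f) (Prop_irrelevance g' g) (Prop_irrelevance h' h).
Qed.

Lemma partition_of_unity_le1 (R : realType) (X : metricType R) (e : R) (N : nat)
    (phi : 'I_N -> X -> R) :
  partition_of_unity e phi -> forall j x, 0 <= phi j x <= 1.
Proof.
case=> _ phi0 phi1 _ j x; rewrite phi0 /= -(phi1 x) (bigD1 j)//= lerDl.
by apply: sumr_ge0 => i _; exact: phi0.
Qed.

Section AvrLebesgue.
Context (R : realType) (X : pmetricType R) (r : R) (n : nat).
Hypotheses (cX : compact [set: X]) (sX : shrinks_on n [set: X]) (r0 : 0 < r).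
Implicit Types (mu nu : AVR X r).

(** For a partition of unity of mesh [e / 2], transport inside classes costs at most [e / 2], and a
    total discrepancy below [e / 2 / B] costs less than [e / 2] across classes. *)
Lemma wasserstein_open_mean_nbhs mu (U : set (AVR X r)) :
  open U -> U mu ->
  exists (N : nat) (phi : 'I_N -> X -> R) (d : R),
    [/\ forall j, continuous (phi j), forall j x, 0 <= phi j x <= 1, 0 < d &
        forall nu,
          \sum_j `|mean (sval mu) (phi j) - mean (sval nu) (phi j)| < d -> U nu].
Proof.
move=> oU Umu; have [e e0 he] : exists2 e : R, 0 < e &
    forall nu, (wasserstein1 (sval mu) (sval nu) < e%:E)%E -> U nu.
  by have : wasserstein_open U by []; apply.
have e20 : 0 < e / 2 by rewrite divr_gt0.
have [N [phi [phiP _]]] := partition_of_unity_exists cX sX e20.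
have [B B0 dB] := compact_dist_bounded cX.
exists N, phi, (e / 2 / B); split; first by case: phiP.
- exact: partition_of_unity_le1 phiP.
- by rewrite divr_gt0.
move=> nu hnu; apply: he.
have [k [x [w [w0 w1 _ muE]]]] := avr_representation mu.
have [l [y [v [v0 v1 _ nuE]]]] := avr_representation nu.
apply: le_lt_trans
  (wasserstein1_le_partition muE nuE w0 v0 w1 v1 phiP (ltW e20) dB) _.
by move: hnu; rewrite lte_fin ltr_pdivlMr// mulrC; lra.
Qed.

Lemma inhabited_avr : AVR X r.
Proof.
suff /cid[mu _] : exists mu : AVR X r, True by exact: mu.
have [|||mu _] := @avr_of_weights _ X r 1 (fun=> point) (fun=> 1) r0.
- by move=> i; exact: ler01.
- by rewrite big_ord1.
- by move=> i j; rewrite !ord1 eqxx.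
- by exists mu.
Qed.

(** A measure has at most [packing_number X r] atoms, so finitely many compact spaces
    [weighted_packing] map onto the thickening. *)
Lemma compact_avr : compact [set: AVR X r].
Proof.
pose T k := prod_topology (fun _ : 'I_k => (X * R)%type).
have mu0 := inhabited_avr.
have /choice[q qP] (kf : {k : nat & T k}) : exists mu,
    weighted_packing r (projT2 kf) ->
    is_discrete (fun i => (projT2 kf i).2)
      (fun i => (projT2 kf i).1 : borel X) (sval mu).
  case: kf => k f /=.
  have [[f1 f2 f3]|] := pselect (weighted_packing r f); last first.
    by exists mu0.
  have f0 i : 0 <= (f i).2 by case/andP: (f1 i).
  by have [mu muE] := avr_of_weights r0 f0 f2 f3; exists mu.
pose Q k (f : T k) := q (existT _ k f).
have QP k (f : T k) : weighted_packing r f ->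
    is_discrete (fun i => (f i).2) (fun i => (f i).1 : borel X) (sval (Q k f)).
  exact: (qP (existT _ k f)).
(* Continuity is tested on means by [wasserstein_open_mean_nbhs]; these are finite sums [t g j],
   continuous in the points and weights. *)
have Qc k : {within weighted_packing r (k := k), continuous (Q k)}.
  apply/subspace_continuousP => f wf U; rewrite nbhsE => -[W [oW Wf] WU].
  have [N [phi [d [cphi phi01 d0 hd]]]] := wasserstein_open_mean_nbhs oW Wf.
  have phi0 j z : 0 <= phi j z by case/andP: (phi01 j z).
  pose t (g : T k) j := \sum_i (g i).2 * phi j (g i).1.
  have tQ g j : weighted_packing r g -> mean (sval (Q k g)) (phi j) = t g j.
    move=> wg; have gE := QP k g wg.
    have g0 i : 0 <= (g i).2 by case: wg => H _ _; case/andP: (H i).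
    exact: (meanE gE).
  have ct : \sum_j `|t f j - t g j| @[g --> f] --> \sum_j `|t f j - t f j|.
    apply: (@cvg_sumr _ _ _ _ (nbhs_filter f)) => j.
    apply: (@cvg_norm _ R^o); apply: (@cvgB _ R^o); first exact: cvg_cst.
    apply: (@cvg_sumr _ _ _ _ (nbhs_filter f)) => i.
    apply: cvgM; first exact: (point_weight_cvg f i).2.
    by apply: cvg_comp (point_weight_cvg f i).1 _; exact: cphi.
  have t0 : \sum_j `|t f j - t f j| < d.
    by rewrite big1// => j _; rewrite subrr normr0.
  have H : nbhs f [set g | \sum_j `|t f j - t g j| < d] by exact: (cvgr_lt _ ct).
  apply: filterS H => g hg wg; apply: WU; apply: hd.
  by under eq_bigr do rewrite !tQ//.
rewrite (_ : setT = \big[setU/set0]_(k < (packing_number X r).+1)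
    (Q k @` weighted_packing r (k := k))).
  apply: bigsetU_compact => -[k kp] _ /=.
  apply: continuous_compact; first exact: Qc.
  exact: compact_weighted_packing.
apply/esym/seteqP; split => // mu _.
have [k [x [l [l0 l1 xr muE]]]] := avr_representation mu.
have kp : (k < (packing_number X r).+1)%N by rewrite ltnS; exact: packing_le xr.
pose f : T k := fun i => (x i, l i).
have wf : weighted_packing r f.
  split => //= i; rewrite l0 /= -l1 (bigD1 i)//= lerDl.
  by apply: sumr_ge0 => j _; exact: l0.
rewrite (bigD1 (Ordinal kp))//=; left; exists f => //.
have := QP k f wf; case: (Q k f) muE => [P aP]; case: mu => [P' aP'] /= PE' PE.
by apply: eq_exist; apply: probability_ext => A; rewrite PE PE'.
Qed.

(** A Lebesgue number expressed in finitely many means. Every measure has a neighbourhood of radius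
    [d + d] inside a member of [C]; finitely many of radius [d] cover, all their test functions are
    collected, and the final radius is below every [d]. *)
Lemma avr_lebesgue (C : set (set (AVR X r))) : open_cover C ->
  exists (J : finType) (psi : J -> X -> R) (d : R),
    [/\ forall j, continuous (psi j), forall j x, 0 <= psi j x <= 1, 0 < d &
        forall mu, exists2 U, C U & forall nu,
          (forall j, `|mean (sval mu) (psi j) - mean (sval nu) (psi j)| < d) ->
          U nu].
Proof.
move=> [oC cC].
pose D := ({N : nat & 'I_N -> X -> R} * R * set (AVR X r))%type.
pose good mu (D : D) := let: (existT N phi, d, U) := D in
  [/\ forall j, continuous (phi j), forall j x, 0 <= phi j x <= 1, 0 < d, C U &
        forall nu,
          (forall j, `|mean (sval mu) (phi j) - mean (sval nu) (phi j)| < d + d) ->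
          U nu].
have /choice[data dataP] : forall mu, exists D : D, good mu D.
  move=> mu; have [U CU Umu] := cC mu.
  have [N [phi [d [cphi phi01 d0 hd]]]] := wasserstein_open_mean_nbhs (oC _ CU) Umu.
  have N0 : 0 < (N.+1%:R : R) by [].
  (* [N] terms of size [d / N.+1%:R] add up to less than [d], even for [N = 0]; the factor 2 pays
     for the doubled radius in [good]. *)
  exists (existT _ N phi, d / N.+1%:R / 2, U); split => //.
    by rewrite !divr_gt0.
  move=> nu; rewrite -splitr => hnu; apply: hd.
  apply: (@le_lt_trans _ _ (\sum_(j < N) d / N.+1%:R)).
    by apply: ler_sum => j _; exact: ltW.
  rewrite sumr_const card_ord -[ltLHS]mulr_natr -mulrA -[ltRHS]mulr1 ltr_pM2l//.
  by rewrite mulrC ltr_pdivrMr// mul1r ltr_nat.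
pose nb mu : set (AVR X r) := let: (existT N phi, d, U) := data mu in
  [set nu : AVR X r | forall j, `|mean (sval mu) (phi j) - mean (sval nu) (phi j)| < d].
have nbP mu : [set: AVR X r] mu -> exists mu', nbhs mu (nb mu').
  move=> _; exists mu; rewrite /nb; have := dataP mu.
  case: (data mu) => [[[N phi] d] U] /= [cphi phi01 d0 _ _].
  have H : \forall nu \near mu, forall j : 'I_N,
      `|mean (sval mu) (phi j) - mean (sval nu) (phi j)| < d.
    apply: (@filter_forall _ _ _ _ (nbhs_filter (mu : AVR X r))) => j.
    exact: mean_nbhs.
  exact: H.
have [L [g gP]] := compact_finite_cover compact_avr nbP.
pose N a := projT1 (data (g a)).1.1.
pose psi (j : {a : 'I_L & 'I_(N a)}) : X -> R :=
  projT2 (data (g (projT1 j))).1.1 (projT2 j).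
pose d a := (data (g a)).1.2.
have d0 a : 0 < d a.
  by rewrite /d; have := dataP (g a); case: (data (g a)) => [[[? ?] ?] ?] [].
have [e [e0 he]] : exists e : R, 0 < e /\ forall a, e <= d a.
  have : \forall e \near 0^'+, forall a, e <= d a.
    by apply: filter_forall => a; exact: nbhs_right_le.
  by move=> H; exact: filter_ex (filterI (nbhs_right_gt 0) H).
exists {a : 'I_L & 'I_(N a)}, psi, e; split => //.
- move=> [a j]; rewrite /psi /=; move: j; rewrite /N.
  by have := dataP (g a); case: (data (g a)) => [[[? ?] ?] ?] [].
- move=> [a j]; rewrite /psi /=; move: j; rewrite /N.
  by have := dataP (g a); case: (data (g a)) => [[[? ?] ?] ?] [].
move=> mu; have [a mua] := gP mu Logic.I.
have psiE : forall nu, (forall j, `|mean (sval mu) (psi j) - mean (sval nu) (psi j)| < e)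
  -> forall j, `|mean (sval mu) (projT2 (data (g a)).1.1 j) -
                 mean (sval nu) (projT2 (data (g a)).1.1 j)| < d a.
  by move=> nu H j; apply: lt_le_trans (he a); exact: (H (existT _ a j)).
move: mua psiE; rewrite /nb /d; have := dataP (g a).
case: (data (g a)) => [[[M phi] d'] U] /= [cphi phi01 d'0 CU hU] mua psiE.
exists U => // nu /psiE H; apply: hU => j.
apply: le_lt_trans (ler_distD (mean (sval mu) (phi j)) _ _) _.
by apply: ltrD; [exact: mua|exact: H].
Qed.

End AvrLebesgue.

(** * The simplicial skeleton *)

Section Skeleton.
Context (R : realType) (N : nat).

Definition face (s : {set 'I_N}) : set 'rV[R]_N :=
  [set v | [/\ forall j, 0 <= v 0 j, \sum_j v 0 j = 1 &
               forall j, j \notin s -> v 0 j = 0]].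

Lemma face_closed s : closed (face s).
Proof.
have cc j : continuous (fun v : 'rV[R]_N => v 0 j) by exact: coord_continuous.
have cs : continuous (fun v : 'rV[R]_N => \sum_j v 0 j).
  by move=> v; apply: (@cvg_sumr _ _ _ _ (nbhs_filter v)) => j; exact: cc.
rewrite (_ : face s = \bigcap_j (fun v : 'rV[R]_N => v 0 j) @^-1` [set x | 0 <= x]
  `&` ((fun v : 'rV[R]_N => \sum_j v 0 j) @^-1` [set 1] `&`
  \bigcap_(j in [set j | j \notin s])
     (fun v : 'rV[R]_N => v 0 j) @^-1` [set 0])).
  apply: closedI; last apply: closedI.
  - apply: closed_bigI => j _; apply: closed_comp => [v _|]; [exact: cc|].
    exact: closed_ge.
  - by apply: closed_comp => [v _|]; [exact: cs|exact: closed_eq].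
  - apply: closed_bigI => j _; apply: closed_comp => [v _|]; [exact: cc|].
    exact: closed_eq.
apply/seteqP; split => v.
  by move=> [v0 v1 vs]; split=> [j _|]; [exact: v0|split=> // j js; exact: vs].
by move=> [v0 [v1 vs]]; split=> [j||j js];
  [exact: (v0 j Logic.I)|exact: v1|exact: (vs j js)].
Qed.

Lemma face_compact s : compact (face s).
Proof.
apply: (subclosed_compact (@face_closed s)
  (@rV_compact R^o N (fun _ => `[0, 1]%classic) (fun=> @segment_compact _ _ _))).
move=> v [v0 v1 _] j; rewrite /= in_itv /= v0 /= -v1 (bigD1 j)//= lerDl.
by apply: sumr_ge0 => i _; exact: v0.
Qed.

(* The coordinates of a face sum to 1, so one of them can be dropped. *)
Lemma face_shrinks_on (m : nat) (s : {set 'I_N}) : (#|s| <= m.+1)%N -> shrinks_on m (face s).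
Proof.
move=> sm; have [s0|[j0 j0s]] := set_0Vmem s.
  apply: (@shrinks_on_sub _ _ _ set0) => [v [_ v1 vs]|].
    move: v1; rewrite big1; first by move/eqP; rewrite eq_sym oner_eq0.
    by move=> j _; apply: vs; rewrite s0 inE.
  exact: shrinks_on0.
pose e := enum (s :\ j0).
have esz : (size e <= m)%N.
  by rewrite -cardE; move: sm; rewrite (cardsD1 j0) j0s.
(* If [s] has fewer than [m.+1] vertices, the surplus coordinates repeat that of [j0], the default
   of [nth]. *)
apply: (@embedded_shrinks_on _ _ R _
  (fun (v : 'rV[R]_N) (k : 'I_m) => v 0 (nth j0 e k))).
- exact: face_compact.
- exact: face_closed.
- by move=> v _ k; exact: coord_continuous.
move=> u v [_ u1 us] [_ v1 vs] uv.
have offj0 j : j != j0 -> u 0 j = v 0 j.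
  move=> jj0; have [js|js] := boolP (j \in s); last by rewrite us ?vs.
  have je : j \in e by rewrite mem_enum !inE jj0.
  have ki : (index j e < m)%N by apply: leq_trans esz; rewrite index_mem.
  by have := congr1 (@^~ (Ordinal ki)) uv; rewrite /= nth_index.
apply/rowP => j; have [->|] := eqVneq j j0; last exact: offj0.
have : \sum_j u 0 j = \sum_j v 0 j by rewrite u1 v1.
rewrite (bigD1 j0)//= [in RHS](bigD1 j0)//= (eq_bigr (fun j => v 0 j)) => [|i].
  exact: addIr.
exact: offj0.
Qed.

End Skeleton.

(** * Pulling covers back from the skeleton to the thickening *)

Lemma avr_covering_dim_le (R : realType) (X : pmetricType R) (n : nat) (r : R) :
  compact [set: X] -> shrinks_on n [set: X] -> 0 < r ->
  covering_dim_le (AVR X r) (n.+1 * packing_number X r - 1).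
Proof.
move=> cX sX r0 C oC; set p := packing_number X r.
have mu0 := inhabited_avr X r0.
(* Some measure exists and has an atom, so [p] is positive and the truncated subtraction in the
   bound is a genuine one. *)
have p0 : (0 < p)%N.
  have [k [x [l [_ l1 xr _]]]] := avr_representation mu0.
  apply: leq_trans (packing_le cX r0 xr).
  by case: k x l l1 {xr} => // x l; rewrite big_ord0 => /eqP;
    rewrite eq_sym oner_eq0.
have np0 : (0 < n.+1 * p)%N by rewrite muln_gt0.
have mE : (n.+1 * p - 1).+1 = (n.+1 * p)%N by rewrite subn1 prednK.
have [J [psi [d [cpsi psi01 d0 hd]]]] := avr_lebesgue cX sX r0 oC.
(* [mean_partition_close] adds two oscillations and one sum of discrepancies; three terms of at most
   [d / 4] stay strictly below [d]. *)
have d40 : 0 < d / 4 by rewrite divr_gt0.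
have [e [e0 he]] : exists e : R, 0 < e /\
    forall j x y, mdist x y < e -> `|psi j x - psi j y| <= d / 4.
  have /choice[g gP] : forall j, exists e : R, 0 < e /\
      forall x y, mdist x y < e -> `|psi j x - psi j y| <= d / 4.
    move=> j; have [e e0 he] := compact_uniform_continuity cX (cpsi j) d40.
    by exists e.
  have H : \forall e \near 0^'+, forall j, e <= g j.
    by apply: filter_forall => j; apply: nbhs_right_le; case: (gP j).
  have [e [e0 eg]] := filter_ex (filterI (nbhs_right_gt 0) H).
  exists e; split => // j x y xy; apply: (gP j).2.
  exact: lt_le_trans xy (eg j).
have [N [phi [phiP phin]]] := partition_of_unity_exists cX sX e0.
have phi01 := partition_of_unity_le1 phiP.
have [cphi phi0 phi1 _] := phiP.
pose t (mu : AVR X r) : 'rV[R]_N := \row_j mean (sval mu) (phi j).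
have tE mu j : t mu 0 j = mean (sval mu) (phi j) by rewrite mxE.
have t_close mu nu : (forall j, `|t mu 0 j - t nu 0 j| < d / 4 / N.+1%:R) ->
    forall j, `|mean (sval mu) (psi j) - mean (sval nu) (psi j)| < d.
  move=> mn j.
  have [k [x [w [w0 w1 _ muE]]]] := avr_representation mu.
  have [l [y [v [v0 v1 _ nuE]]]] := avr_representation nu.
  have := mean_partition_close muE nuE w0 v0 w1 v1 phiP (cpsi j) (psi01 j) (he j).
  have : \sum_j `|mean (sval mu) (phi j) - mean (sval nu) (phi j)| <= d / 4.
    apply: (@le_trans _ _ (\sum_(j < N) d / 4 / N.+1%:R)).
      by apply: ler_sum => i _; rewrite -!tE ltW.
    rewrite sumr_const card_ord -[leLHS]mulr_natr -mulrA -[leRHS]mulr1.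
    rewrite ler_pM2l// mulrC ler_pdivrMr// mul1r ler_nat; exact: leqnSn.
  lra.
have t_cont (O : set 'rV[R]_N) : open O -> open (t @^-1` O).
  move=> oO; rewrite openE => mu Omu.
  have /nbhs_ballP[a /= a0 aO] : nbhs (t mu) O by exact: open_nbhs_nbhs.
  have H : \forall nu \near mu, forall j : 'I_N,
      `|mean (sval mu) (phi j) - mean (sval nu) (phi j)| < a.
    apply: (@filter_forall _ _ _ _ (nbhs_filter mu)) => j.
    exact: mean_nbhs.
  apply: filterS H => nu nuP; apply: aO; split => // i j.
  by rewrite ord1 /ball /= !tE.
(* Faces with too many vertices are replaced by the empty set, so that the skeleton is a union over
   the finite type of all [s]. *)
pose F := fun s : {set 'I_N} => [set v : 'rV[R]_N | (#|s| <= n.+1 * p)%N /\ face s v].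
have sF : shrinks_on (n.+1 * p - 1) (\bigcup_s F s).
  apply: shrinks_on_bigcup => s; have [sm|sm] := leqP #|s| (n.+1 * p).
    apply: shrinks_on_sub (@face_shrinks_on R N _ s _) => [v []//|].
    by rewrite mE.
  apply: (@shrinks_on_sub _ _ _ set0) => [v [/=]|]; first by rewrite leqNgt sm.
  exact: shrinks_on0.
have tF mu : (\bigcup_s F s) (t mu).
  have [k [x [w [w0 w1 xr muE]]]] := avr_representation mu.
  have tw j : t mu 0 j = \sum_i w i * phi j (x i) by rewrite tE (meanE muE).
  (* There are at most [p] atoms, and at most [n.+1] functions are nonzero at each. *)
  pose s := (\bigcup_(i < k) [set j | phi j (x i) != 0])%SET.
  exists s => //; split.
    apply: (@leq_trans (\sum_(i < k) n.+1)).
      apply: (@leq_trans (\sum_(i < k) #|[set j | phi j (x i) != 0%R]%SET|));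
        last by apply: leq_sum => i _; exact: phin.
      rewrite /s; elim/big_ind2: _ => [|A a B b Aa Bb|//]; first by rewrite cards0.
      by apply: leq_trans (leq_add Aa Bb); rewrite cardsU leq_subr.
    rewrite sum_nat_const card_ord mulnC leq_mul2l /=.
    exact: packing_le xr.
  split => [j||j js].
  - by rewrite tw; apply: sumr_ge0 => i _; exact: mulr_ge0.
  - under eq_bigr do rewrite tw.
    rewrite exchange_big /= -w1; apply: eq_bigr => i _.
    by rewrite -mulr_sumr phi1 mulr1.
  - rewrite tw big1// => i _; apply/eqP; rewrite mulf_eq0; apply/orP; right.
    apply: contraNT js => ji; apply/bigcupP; exists i => //.
    by rewrite inE.
(* Half the threshold of [t_close], because two points of [V z] are compared through the centre
   [z]. *)
pose a := d / 4 / N.+1%:R / 2.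
have a0 : 0 < a by rewrite !divr_gt0.
have [V [oV VU cV dV]] := sF _ (fun z : 'rV[R]_N => (ball z a)°)
  (fun z => @open_interior _ _)
  (fun z => ex_intro _ z (nbhsx_ballx z a a0)).
exists [set t @^-1` V z | z in setT].
  split; first by move=> _ [z _ <-]; exact: t_cont.
  by move=> mu; have [z tz] := cV (t mu); exists (t @^-1` V z) => //; exists z.
split.
  move=> _ [z _ <-].
  (* If no measure maps into [V z], the preimage is empty and lies in any member of [C]. *)
  have [[mu Vmu]|H] := pselect (exists mu, V z (t mu)); last first.
    have [U CU _] := oC.2 mu0; exists U => // mu Vmu; exfalso; apply: H.
    by exists mu.
  have [U CU hU] := hd mu; exists U => // nu Vnu; apply: hU; apply: t_close => j.
  have [_ /(_ 0 j) b1] := interior_subset (VU _ _ Vmu).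
  have [_ /(_ 0 j) b2] := interior_subset (VU _ _ Vnu).
  move: b1 b2; rewrite /ball /= => b1 b2.
  apply: le_lt_trans (ler_distD (z 0 j) _ _) _.
  by rewrite (distrC _ (z 0 j)) [ltRHS]splitr ltrD.
(* Different centres may have the same preimage, so there are at most as many sets around [mu] as
   indices at [t mu]. *)
move=> mu; apply: card_le_trans (dV (t mu) (tF mu)).
apply: (@card_le_trans _ _ _ ((fun z => t @^-1` V z) @` [set z | V z (t mu)])).
  apply: subset_card_le => _ [[z _ <-] Vz]; exists z => //.
exact: card_image_le.
Qed.

Theorem theorem6p1 (R : realType) (n : nat) (M : pmetricType R)
    (S : smooth_atlas R n M) (g : riemannian_metric S)
    (M_compact : compact [set: M]) (M_connected : connected [set: M])
    (M_geodesic : forall x y : M, (mdist x y)%:E = geodesic_distance g x y)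
    (r : R) (r_gt0 : 0 < r) :
  let p := packing_number M r in
  covering_dim_le (AVR M r) (n.+1 * p - 1)%N.
Proof.
exact: avr_covering_dim_le M_compact (manifold_shrinks_on S M_compact) r_gt0.
Qed.
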